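(* Let $n\ge 1$, let $E \subseteq \mathbb{S}^n$ be a Borel set and let $C \subseteq \mathbb{S}^n$ be a spherical cap with $\mathcal{H}^n(E) = \mathcal{H}^n(C)$. Then $$P_s(E) \ge P_s(C) \quad \text{for every } s \text{ with } -n < s < 1,$$ and $$P_s(E) \le P_s(C) \quad \text{for every } s \text{ with } -\infty < s < -n.$$ In each of these inequalities, equality is attained if and only if $E$ is itself a spherical cap up to an $\mathcal{H}^n$-nullset.
   Context: $\mathbb{S}^n \subseteq \mathbb{R}^{n+1}$ is the Euclidean unit sphere, $d(x,y)\in[0,\pi]$ is the geodesic distance on $\mathbb{S}^n$, and $\mathcal{H}^n$ is the $n$-dimensional Hausdorff measure (on Borel subsets of $\mathbb{S}^n$ it is the spherical Lebesgue measure). For $s \in (-\infty,1)$ the fractional $s$-perimeter of a Borel set $E \subseteq \mathbb{S}^n$ is $$P_s(E) = \int_E \int_{\mathbb{S}^n\setminus E} \frac{1}{d(x,y)^{n+s}} \, \mathrm{d}\mathcal{H}^n(y)\, \mathrm{d}\mathcal{H}^n(x).$$ A spherical cap is a set of the form $C(v,r) = \{w \in \mathbb{S}^n : d(v,w) < r\}$ with $v \in \mathbb{S}^n$ and $0 \le r < \infty$ (so $C(v,0)=\emptyset$ and $C(v,r)=\mathbb{S}^n$ for $r>\pi$). *)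

(* Defs.v *)
From HB Require Import structures.
From mathcomp Require Import all_boot all_order all_algebra.
From mathcomp Require Import all_classical all_reals all_analysis.

Set Implicit Arguments.
Unset Strict Implicit.
Unset Printing Implicit Defensive.
Import Order.TTheory GRing.Theory Num.Theory.
Import numFieldNormedType.Exports.

Local Open Scope classical_set_scope.
Local Open Scope ring_scope.

Section euclidean.
Context {R : realType} {n : nat}.
Implicit Types x y : 'rV[R]_n.+1.

Definition dot x y : R := \sum_i x 0 i * y 0 i.

(* The library norm `|x| on 'rV[R]_n.+1 is the sup norm; it induces the usual
   topology, but metric notions have to use enorm. *)
Definition enorm x : R := Num.sqrt (dot x x).

Lemma le_norm_enorm x : `|x| <= enorm x.
Proof.
rewrite [leLHS]/Num.Def.normr/= mx_normrE; apply: bigmax_le.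
  exact: sqrtr_ge0.
move=> [i j] _ /=; rewrite (ord1 i) -sqrtr_sqr ler_wsqrtr// /dot (bigD1 j)//=.
by rewrite expr2 lerDl sumr_ge0// => k _; rewrite -expr2 sqr_ge0.
Qed.

End euclidean.

Definition borel (R : realType) (n : nat) :=
  g_sigma_algebraType (@open 'rV[R]_n.+1).
HB.instance Definition _ (R : realType) (n : nat) :=
  Measurable.on (borel R n).

(* Volume of the unit ball of R^k, from
   omega_0 = 1, omega_1 = 2, omega_{k+2} = 2 pi / (k+2) * omega_k. *)
Fixpoint ball_volume (R : realType) (k : nat) : R :=
  match k with
  | 0 => 1
  | 1 => 2
  | k'.+2 => 2 * pi / k%:R * ball_volume R k'
  end.

Section hausdorff_def.
Context {R : realType} {n : nat}.
Implicit Types (A : set 'rV[R]_n.+1) (F : (set 'rV[R]_n.+1)^nat).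
Local Open Scope ereal_scope.

(* equal to -oo when A is empty *)
Definition ediam A : \bar R :=
  ereal_sup [set (enorm (xy.1 - xy.2))%:E | xy in A `*` A].

(* The empty set has weight 0, also for k = 0. *)
Definition hausdorff_weight (k : nat) A : \bar R :=
  if A == set0 then 0 else
    (ball_volume R k / 2 ^+ k)%:E * ediam A ^+ k.

Definition delta_cover (delta : R) A :=
  [set F : (set _)^nat | (forall i, ediam (F i) <= delta%:E) /\ A `<=` \bigcup_i F i].

Definition hausdorff_delta (k : nat) (delta : R) A : \bar R :=
  ereal_inf [set \sum_(i <oo) hausdorff_weight k (F i) |
             F in delta_cover delta A].

Definition hausdorff_outer (k : nat) A : \bar R :=
  ereal_sup [set hausdorff_delta k delta A | delta in [set x : R | (0 < x)%R]].

Definition hausdorff (k : nat) : set (borel R n) -> \bar R := hausdorff_outer k.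

End hausdorff_def.

Section hausdorff_is_measure.
Context {R : realType} {n : nat} (k : nat).
Implicit Types (A B X C : set 'rV[R]_n.+1) (F : (set 'rV[R]_n.+1)^nat).
Local Open Scope ereal_scope.

Lemma ball_volume_ge0 j : (0 <= ball_volume R j)%R.
Proof.
suff: ((0 <= ball_volume R j) && (0 <= ball_volume R j.+1))%R by case/andP.
elim: j => [|j /andP[h1 h2]]; first by rewrite /= ler01 ler0n.
rewrite h2/= mulr_ge0// divr_ge0// ?mulr_ge0 ?pi_ge0//.
Qed.

Lemma ediam_ge0 A : A !=set0 -> 0 <= ediam A.
Proof.
move=> [x Ax]; apply: ereal_sup_ge.
exists (enorm (x - x)%R)%:E; last by rewrite lee_fin sqrtr_ge0.
by exists (x, x).
Qed.

Lemma ediam_set0 : ediam (set0 : set 'rV[R]_n.+1) = -oo.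
Proof. by rewrite /ediam setX0 image_set0 ereal_sup0. Qed.

Lemma hausdorff_weight_ge0 A : 0 <= hausdorff_weight k A.
Proof.
rewrite /hausdorff_weight; case: eqP => // /eqP/set0P A0.
rewrite mule_ge0// ?expe_ge0 ?ediam_ge0//.
by rewrite lee_fin divr_ge0 ?ball_volume_ge0.
Qed.

Lemma hausdorff_weight0 : hausdorff_weight k (set0 : set 'rV[R]_n.+1) = 0.
Proof. by rewrite /hausdorff_weight eqxx. Qed.

Lemma hausdorff_delta_ge0 (d : R) A : 0 <= hausdorff_delta k d A.
Proof.
apply: le_ereal_inf_tmp => x [B [mB AB] <-{x}].
by apply: nneseries_ge0 => *; exact: hausdorff_weight_ge0.
Qed.

Lemma hausdorff_delta0 (d : R) : hausdorff_delta k d (set0 : set 'rV[R]_n.+1) = 0.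
Proof.
apply/eqP; rewrite eq_le hausdorff_delta_ge0 andbT.
apply: ereal_inf_lbound; exists (fun=> set0).
  by split => // i; rewrite ediam_set0 leNye.
by rewrite eseries0// => i _ _; exact: hausdorff_weight0.
Qed.

Lemma le_hausdorff_delta (d : R) :
  {homo (@hausdorff_delta R n k d) : A B / A `<=` B >-> A <= B}.
Proof.
move=> A B AB; apply/ereal_inf_le_tmp => x [B' [mB' BB']].
by move=> <-{x}; exists B' => //; split => //; apply: subset_trans AB BB'.
Qed.

Lemma hausdorff_delta_anti A (d e : R) : (d <= e)%R ->
  hausdorff_delta k e A <= hausdorff_delta k d A.
Proof.
move=> de; apply/ereal_inf_le_tmp => _ [F [dF AF] <-]; exists F => //.
by split => // i; rewrite (le_trans (dF i))// lee_fin.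
Qed.

Lemma hausdorff_delta_sigma_subadditive (d : R) :
  sigma_subadditive (@hausdorff_delta R n k d).
Proof.
set mu := @hausdorff_weight R n k; set nu := hausdorff_delta k d.
move=> A; have [[i ioo]|] := pselect (exists i, nu (A i) = +oo).
  rewrite (eseries_pinfty _ _ ioo) ?leey// => m _.
  by rewrite -ltNye (lt_le_trans _ (hausdorff_delta_ge0 _ _)).
rewrite -forallNE => Aoo.
suff add2e (e : {posnum R}) :
    nu (\bigcup_n A n) <= \sum_(i <oo) nu (A i) + e%:num%:E.
  by apply/lee_addgt0Pr => _/posnumP[].
rewrite (le_trans _ (epsilon_trick _ _ _))//; last first.
  by move=> m; exact: hausdorff_delta_ge0.
pose P m (B : (set 'rV[R]_n.+1)^nat) := delta_cover d (A m) B /\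
  \sum_(k <oo) mu (B k) <= nu (A m) + (e%:num / (2 ^ m.+1)%:R)%:E.
have [G PG] : {G : ((set 'rV[R]_n.+1)^nat)^nat & forall m, P m (G m)}.
  apply: (@choice _ _ P) => m; rewrite /P /nu /hausdorff_delta.
  set S := (X in ereal_inf X); move infS : (ereal_inf S) => iS.
  case: iS infS => [r Sr|Soo|Soo].
  - have en1 : (0 < e%:num / (2 ^ m.+1)%:R)%R by [].
    have /(lb_ereal_inf_adherent en1) : ereal_inf S \is a fin_num by rewrite Sr.
    move=> [x [B [mB AnB muBx] xS]].
    by exists B; split => //; rewrite muBx -Sr; exact/ltW.
  - by have := Aoo m; rewrite /nu /hausdorff_delta Soo.
  - have := hausdorff_delta_ge0 d (A m); rewrite /hausdorff_delta -/S Soo.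
    by rewrite leeNy_eq.
have muG_ge0 x : 0 <= (mu \o uncurry G) x by exact: hausdorff_weight_ge0.
apply: (@le_trans _ _ (\esum_(i in setT) (mu \o uncurry G) i)).
  rewrite /nu /hausdorff_delta; apply: ereal_inf_lbound => /=.
  have /card_esym/ppcard_eqP[f] := card_nat2.
  exists (uncurry G \o f).
    split => [i|]; first by rewrite /=; case: (f i) => a b; exact: (PG a).1.1.
    apply: (@subset_trans _  (\bigcup_n \bigcup_k G n k)) => [t [i _]|].
      by move=> /((PG i).1.2) -[j _ ?]; exists i => //; exists j.
    move=> t [i _ [j _ Bijt]]; exists (f^-1%FUN (i, j)) => //=.
    by rewrite invK ?inE.
  rewrite -(esum_pred_image (mu \o uncurry G) _ xpredT) ?[fun=> _]set_true//.
  by rewrite image_eq.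
rewrite (_ : esum _ _ = \sum_(i <oo) \sum_(j <oo ) mu (G i j)); last first.
  pose J : nat -> set (nat * nat) := fun i => [set (i, j) | j in setT].
  rewrite (_ : setT = \bigcup_k J k); last first.
    by rewrite predeqE => -[a b]; split => // _; exists a => //; exists b.
  rewrite esum_bigcupT /=; last 2 first.
    - apply/trivIsetP => i j _ _ ij.
      rewrite predeqE => -[n' m] /=; split => //= -[] [_] _ [<-{n'} _].
      by move=> [m' _] [] /esym/eqP; rewrite (negbTE ij).
    - by move=> /= [n' m]; exact: (muG_ge0 (n', m)).
  rewrite -(image_id [set: nat]) -fun_true esum_pred_image//; last first.
    by move=> m _; apply: esum_ge0 => x _; exact: (muG_ge0 x).
  apply: eq_eseriesr => /= j _.
  rewrite -(esum_pred_image (mu \o uncurry G) (pair j) predT)//=; last 2 first.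
  - by move=> m _; exact: (muG_ge0 (j, m)).
  - by move=> ? ? _ _; exact: (@can_inj _ _ _ snd).
  by congr esum; rewrite predeqE => -[a b]; split; move=> [i _ <-]; exists i.
apply: lee_lim.
- apply: is_cvg_nneseries => m *.
  by apply: nneseries_ge0 => m' *; exact: (muG_ge0 (m, m')).
- apply: is_cvg_nneseries => m *; apply: adde_ge0 => //.
  exact: hausdorff_delta_ge0.
- by near=> m; apply: lee_sum => i _; exact: (PG i).2.
Unshelve. all: by end_near. Qed.

Lemma hausdorff_delta_le (d : R) A : (0 < d)%R ->
  hausdorff_delta k d A <= hausdorff_outer k A.
Proof. by move=> d0; apply: ereal_sup_ubound; exists d. Qed.

Lemma hausdorff_outer_ge0 A : 0 <= hausdorff_outer k A.
Proof.
exact: le_trans (hausdorff_delta_ge0 1 A) (hausdorff_delta_le A ltr01).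
Qed.

Lemma hausdorff_outer0 : hausdorff_outer k (set0 : set 'rV[R]_n.+1) = 0.
Proof.
apply/eqP; rewrite eq_le hausdorff_outer_ge0 andbT.
by apply: ge_ereal_sup => _ [d _ <-]; rewrite hausdorff_delta0.
Qed.

Lemma le_hausdorff_outer :
  {homo (@hausdorff_outer R n k) : A B / A `<=` B >-> A <= B}.
Proof.
move=> A B AB; apply: ge_ereal_sup => _ [d d0 <-].
exact: le_trans (le_hausdorff_delta d AB) (hausdorff_delta_le B d0).
Qed.

Lemma hausdorff_outer_sigma_subadditive :
  sigma_subadditive (@hausdorff_outer R n k).
Proof.
move=> F; apply: ge_ereal_sup => _ [d d0 <-].
apply: (le_trans (@hausdorff_delta_sigma_subadditive d F)).
by apply: lee_nneseries => *; [exact: hausdorff_delta_ge0|exact: hausdorff_delta_le].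
Qed.

HB.instance Definition _ := isOuterMeasure.Build R 'rV[R]_n.+1
  (@hausdorff_outer R n k) hausdorff_outer0 hausdorff_outer_ge0
  le_hausdorff_outer hausdorff_outer_sigma_subadditive.

Lemma hausdorff_delta_separated (d : R) A B :
  (forall a b, A a -> B b -> (d < `|a - b|)%R) ->
  hausdorff_delta k d A + hausdorff_delta k d B <= hausdorff_delta k d (A `|` B).
Proof.
move=> dAB; apply: le_ereal_inf_tmp => _ [F [dF ABF] <-].
pose G C i := if pselect (F i `&` C !=set0) then F i else set0.
have GC C : C `<=` A `|` B -> delta_cover d C (G C).
  move=> CAB; split => [i|x Cx].
    by rewrite /G; case: pselect => h //=; rewrite ediam_set0 leNye.
  have [i _ Fix] := ABF _ (CAB _ Cx); exists i => //.
  by rewrite /G; case: pselect => // h; exfalso; apply: h; exists x.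
apply: (@le_trans _ _ (\sum_(i <oo) hausdorff_weight k (G A i) +
                       \sum_(i <oo) hausdorff_weight k (G B i))).
  by apply: leeD; apply: ereal_inf_lbound; [exists (G A)|exists (G B)] => //;
    apply: GC; [exact: subsetUl|exact: subsetUr].
rewrite -nneseriesD; last 2 first.
- by move=> *; exact: hausdorff_weight_ge0.
- by move=> *; exact: hausdorff_weight_ge0.
apply: lee_nneseries => i *.
  by rewrite adde_ge0// hausdorff_weight_ge0.
rewrite /G; case: pselect => [hA|hA]; case: pselect => [hB|hB] /=;
  rewrite ?hausdorff_weight0 ?adde0 ?add0e ?hausdorff_weight_ge0//.
have [[a [Fa Aa]] [b [Fb Bb]]] := (hA, hB).
have := dF i; rewrite leNgt => /negP; case.
apply: (@lt_le_trans _ _ (enorm (a - b))%:E).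
  by rewrite lte_fin (lt_le_trans (dAB _ _ Aa Bb))// le_norm_enorm.
by apply: ereal_sup_ubound; exists (a, b).
Qed.

Lemma hausdorff_separated (e : R) A B : (0 < e)%R ->
  (forall a b, A a -> B b -> (e <= `|a - b|)%R) ->
  hausdorff_outer k A + hausdorff_outer k B <= hausdorff_outer k (A `|` B).
Proof.
move=> e0 eAB.
have key (d1 d2 : R) : (0 < d1)%R -> (0 < d2)%R ->
    hausdorff_delta k d1 A + hausdorff_delta k d2 B <= hausdorff_outer k (A `|` B).
  move=> d10 d20; pose d : R := Num.min (e / 2)%R (Num.min d1 d2).
  have d0 : (0 < d)%R by rewrite !lt_min divr_gt0//= d10.
  have de : (d < e)%R.
    by rewrite gt_min; apply/orP; left; rewrite ltr_pdivrMr// ltr_pMr// ltr1n.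
  have dd1 : (d <= d1)%R by rewrite !ge_min lexx !orbT.
  have dd2 : (d <= d2)%R by rewrite !ge_min lexx !orbT.
  apply: le_trans (leeD (hausdorff_delta_anti A dd1) (hausdorff_delta_anti B dd2)) _.
  apply: le_trans (hausdorff_delta_le _ d0).
  apply: hausdorff_delta_separated => a b Aa Bb.
  exact: lt_le_trans de (eAB _ _ Aa Bb).
have [->|ABoo] := eqVneq (hausdorff_outer k (A `|` B)) +oo; first exact: leey.
have ABfin : hausdorff_outer k (A `|` B) \is a fin_num.
  by rewrite ge0_fin_numE ?hausdorff_outer_ge0// ltey.
have fin C : C `<=` A `|` B -> hausdorff_outer k C \is a fin_num.
  move=> CAB; rewrite ge0_fin_numE ?hausdorff_outer_ge0//.
  by rewrite (le_lt_trans (le_hausdorff_outer CAB))// ltey.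
have fA := fin _ (@subsetUl _ A B); have fB := fin _ (@subsetUr _ A B).
have find C d : (0 < d)%R -> hausdorff_outer k C \is a fin_num ->
    hausdorff_delta k d C \is a fin_num.
  move=> d0; rewrite !ge0_fin_numE ?hausdorff_outer_ge0 ?hausdorff_delta_ge0//.
  exact/le_lt_trans/hausdorff_delta_le.
rewrite -leeBrDr//; apply: ge_ereal_sup => _ [d1 d10 <-].
rewrite leeBrDr// addeC -leeBrDr ?find//; apply: ge_ereal_sup => _ [d2 d20 <-].
by rewrite leeBrDr ?find// addeC key.
Qed.

Lemma lee_sum_hausdorff_sparse (Q : (set 'rV[R]_n.+1)^nat) :
  (forall m, exists2 e : R, (0 < e)%R &
    forall i, (i < m)%N -> forall x y, Q i x -> Q m y -> (e <= `|x - y|)%R) ->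
  forall N, \sum_(i < N) hausdorff_outer k (Q i) <=
            hausdorff_outer k (\bigcup_(i in `I_N) Q i).
Proof.
move=> H; elim=> [|N ih]; first by rewrite big_ord0 hausdorff_outer_ge0.
rewrite big_ord_recr /= (le_trans (leeD2r _ ih))//.
have [e e0 he] := H N; rewrite (le_trans (hausdorff_separated e0 _))//.
  by move=> a b [i /= iN Qia] QNb; exact: he iN _ _ Qia QNb.
apply: le_hausdorff_outer => x [[i /= iN Qi]|Qx]; last by exists N => /=.
by exists i => //=; rewrite (ltn_trans iN).
Qed.

Lemma closed_hausdorff_caratheodory C : closed C ->
  (@hausdorff_outer R n k).-caratheodory C.
Proof.
move=> Ccl; apply: le_caratheodory_measurable => X /=.
set mu := @hausdorff_outer R n k.
have [->|Xoo] := eqVneq (mu X) +oo; first exact: leey.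
pose r (j : nat) : R := j.+1%:R^-1%R.
have r0 j : (0 < r j)%R by rewrite invr_gt0.
have rS j : (r j.+1 < r j)%R by rewrite ltf_pV2 ?posrE ?ltr0n// ltr_nat.
have rle i j : (i <= j)%N -> (r j <= r i)%R.
  by move=> ij; rewrite lef_pV2 ?posrE ?ltr0n// ler_nat.
pose Y j := [set x | X x /\ forall c, C c -> (r j <= `|x - c|)%R].
have YS i j : (i <= j)%N -> Y i `<=` Y j.
  move=> ij x [Xx h]; split => // c Cc.
  exact: le_trans (rle _ _ ij) (h _ Cc).
have YX j : Y j `<=` X by move=> x [].
have XCY : X `&` ~` C `<=` \bigcup_j Y j.
  move=> x [Xx Cx].
  have /nbhs_ballP[e /= e0 eC] : nbhs x (~` C).
    by apply: open_nbhs_nbhs; split => //; exact: closed_openC.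
  have [j _ je] : exists2 j, True & (r j <= e)%R.
    exists (Num.truncn e^-1) => //; rewrite /r invf_ple ?posrE ?ltr0n//.
    exact/ltW/truncnS_gt.
  exists j => //; split => // c Cc; rewrite leNgt; apply/negP => xc.
  apply: (eC c) => //; rewrite -ball_normE /=; exact: lt_le_trans xc je.
pose Q j := Y j.+1 `\` Y j.
have QX j : Q j `<=` X by move=> x [/YX].
have muX : mu X < +oo by rewrite ltey.
have sep i j x y : (i.+1 < j.+1)%N -> Q i x -> Q j.+1 y ->
    (r j - r j.+1 <= `|x - y|)%R.
  move=> ij [[Xx hx] _] [[Xy _] /not_andP[//|]].
  move=> /existsNP[c /not_implyP[Cc /negP]]; rewrite -ltNge => yc.
  have h1 := hx _ Cc; have h2 := ler_distD y x c.
  have h3 : (r j <= r i.+1)%R by exact: rle.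
  rewrite lerBlDr (le_trans h3)// (le_trans h1)// (le_trans h2)//.
  by rewrite lerD2l ltW.
have sumQ N : \sum_(i < N) mu (Q i) <= mu X + mu X.
  have sparse (b : bool) M : \sum_(i < M) mu (Q (i.*2 + b)%N) <= mu X.
    apply: (@le_trans _ _ (mu (\bigcup_(i in `I_M) Q (i.*2 + b)%N))); last first.
      by apply: le_hausdorff_outer => x [i _] /QX.
    apply: (lee_sum_hausdorff_sparse (Q := fun i => Q (i.*2 + b)%N)) => m.
    case: m => [|m]; first by exists 1%R.
    exists (r (m.*2.+1 + b)%N - r (m.*2.+1 + b).+1)%R; first by rewrite subr_gt0.
    move=> i im x y Qx Qy; apply: (sep _ (m.*2.+1 + b)%N _ _ _ Qx Qy).
    by rewrite ltnS addSn ltnS leq_add2r leq_double.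
  apply: le_trans (leeD (sparse false N) (sparse true N)).
  rewrite -big_split/=.
  apply: (@le_trans _ _ (\sum_(i < N.*2) mu (Q i))).
    rewrite -!(big_mkord xpredT (fun i => mu (Q i))).
    rewrite [leRHS](@big_cat_nat _ _ _ N)//=; last by rewrite -addnn leq_addr.
    by rewrite leeDl// sume_ge0// => i _; exact: hausdorff_outer_ge0.
  elim: N => [|N ih]; first by rewrite !big_ord0.
  rewrite doubleS !big_ord_recr/= -addeA leeD// addn0 addn1.
  by [].
have tail0 : (\sum_(N <= i <oo) mu (Q i)) @[N --> \oo] --> 0.
  apply: nneseries_tail_cvg => //; last by move=> *; exact: hausdorff_outer_ge0.
  apply: (@le_lt_trans _ _ (mu X + mu X)); last by rewrite lte_add_pinfty.
  apply: lime_le; first by apply: is_cvg_nneseries => *; exact: hausdorff_outer_ge0.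
  by apply: nearW => N; rewrite big_mkord.
have main N : mu (X `&` C) + mu (X `&` ~` C) <=
    mu X + \sum_(N <= i <oo) mu (Q i).
  apply: (@le_trans _ _ (mu (X `&` C) +
      (mu (Y N) + \sum_(N <= i <oo) mu (Q i)))).
    rewrite leeD2l//.
    apply: le_trans (leeD2l _ (outer_measure_sigma_subadditive_tail mu N Q)).
    apply: le_trans (outer_measureU2 mu _ _).
    apply: le_hausdorff_outer => x /XCY[j _].
    elim: j => [|j ih] Yx; first by left; exact: YS Yx.
    have [/ih//|nYx] := pselect (Y j x).
    have [jN|Nj] := leqP j.+1 N; first by left; exact: YS Yx.
    by right; exists j => //=; apply/negP; rewrite -leqNgt.
  rewrite addeA leeD2r//.
  rewrite addeC; apply: (le_trans (hausdorff_separated (r0 N) _)).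
    by move=> a b [_ h] [_ /h].
  by apply: le_hausdorff_outer => x [[]|[]].
have muXfin : mu X \is a fin_num.
  by rewrite ge0_fin_numE// hausdorff_outer_ge0.
have lim : (fun N => mu X + \sum_(N <= i <oo) mu (Q i)) @ \oo --> mu X.
  rewrite -[X in _ --> X]adde0; apply: cvgeD => //.
  - by rewrite fin_num_adde_defr.
  - exact: cvg_cst.
rewrite -(cvg_lim _ lim)//; apply: lime_ge; last exact: nearW.
by apply/cvg_ex; exists (mu X).
Qed.

Lemma borel_hausdorff_caratheodory (A : set (borel R n)) : measurable A ->
  (@hausdorff_outer R n k).-caratheodory A.
Proof.
apply: smallest_sub.
  split.
  - exact: caratheodory_measurable_set0.
  - by move=> B mB; rewrite setTD; exact: caratheodory_measurable_setC.
  - by move=> F mF; exact: caratheodory_measurable_bigcup.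
move=> U oU; rewrite -(setCK U); apply: caratheodory_measurable_setC.
by apply: closed_hausdorff_caratheodory; exact: open_closedC.
Qed.

Lemma hausdorff_semi_sigma_additive : semi_sigma_additive (@hausdorff R n k).
Proof.
move=> F mF tF mbF.
apply: (@caratheodory_measure_sigma_additive R _ (@hausdorff_outer R n k)) => //.
- by move=> i; apply: borel_hausdorff_caratheodory; exact: mF.
- exact: borel_hausdorff_caratheodory.
Qed.

HB.instance Definition _ := isMeasure.Build _ (borel R n) R (@hausdorff R n k)
  hausdorff_outer0 hausdorff_outer_ge0 hausdorff_semi_sigma_additive.

End hausdorff_is_measure.

Section sphere.
Context {R : realType} {n : nat}.
Implicit Types (v x y : 'rV[R]_n.+1).

Definition sphere : set (borel R n) := [set x : 'rV[R]_n.+1 | enorm x = 1].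

(* Geodesic (angular) distance between points of the sphere. *)
Definition gdist x y : R := acos (dot x y).

Definition cap v (r : R) : set (borel R n) :=
  [set w | sphere w /\ gdist v w < r].

Definition spherical_cap (C : set (borel R n)) :=
  exists v r, [/\ sphere v, 0 <= r & C = cap v r].

Local Open Scope ereal_scope.

Definition spherical_cap_ae (E : set (borel R n)) :=
  exists2 C, spherical_cap C & hausdorff n (E `+` C) = 0.

Definition frac_perimeter (s : R) (E : set (borel R n)) : \bar R :=
  \int[hausdorff n]_(x in E) \int[hausdorff n]_(y in sphere `\` E)
    ((gdist x y `^ (n%:R + s))^-1)%:E.

End sphere.

Arguments sphere : clear implicits.

(* Main.v *)
(** The proof is by two-point symmetrization.  For a unit vector [v], polarizing [A]
    moves, inside each pair [x, refl v x] that meets [A] in one point, this point to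
    the side [dot x v > 0].  It preserves the measure, and a four-point comparison
    shows that it does not increase the double integral of a kernel that increases
    with [dot x y] over [A] times its complement; the loss is an integral over the
    product of the kept and of the swapped points.

    Polarizations converge to the cap [C] by an averaging argument:
    [v |-> refl v y] is Lipschitz and onto, so by the definition of the Hausdorff
    measure the law of a random reflection of [y] is at least a multiple of the
    surface measure; hence some polarization towards the centre of [C] increases the
    measure of the intersection with [C] by a multiple of the square of the measure
    of [C `\` A].  The inequality follows for bounded kernels by continuity and for
    singular ones by truncation.

    In case of equality with a finite perimeter, for each [v] the kept or the swapped
    points are negligible; taking as centre the direction of the barycenter of [A], it
    is always the swapped ones, no polarization gains anything, and the averaging
    argument yields that [A] is a cap.

    That caps have finite perimeter for [s < 1] comes from two applications of the
    conformal group: dilating a hemisphere bounds small balls by [r ^+ n], and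
    the disjoint comparable images of a thin shell bound its measure by a multiple of
    its width.  For [s < - n] the argument applies to [pi^(-(n+s)) - d^(-(n+s))]. *)
Require Import Defs.
From HB Require Import structures.
From mathcomp Require Import all_boot all_order all_algebra.
From mathcomp Require Import all_classical all_reals all_analysis.
From mathcomp Require Import measurable_realfun.
From mathcomp Require Import ring lra zify.

Set Implicit Arguments.
Unset Strict Implicit.
Unset Printing Implicit Defensive.
Import Order.TTheory GRing.Theory Num.Theory.
Import numFieldNormedType.Exports.

Local Open Scope classical_set_scope.
Local Open Scope ring_scope.

(** * Inner product, points of the sphere, and reflections *)

Section dot_theory.
Context {R : realType} {n : nat}.
Implicit Types (u v x y z : 'rV[R]_n.+1) (a : R).

Lemma dotC x y : dot x y = dot y x.
Proof. by apply: eq_bigr => i _; rewrite mulrC. Qed.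

Lemma dotDl x y z : dot (x + y) z = dot x z + dot y z.
Proof. by rewrite -big_split/=; apply: eq_bigr => i _; rewrite mxE mulrDl. Qed.

Lemma dotZl a x y : dot (a *: x) y = a * dot x y.
Proof. by rewrite mulr_sumr; apply: eq_bigr => i _; rewrite mxE mulrA. Qed.

Lemma dotNl x y : dot (- x) y = - dot x y.
Proof. by rewrite -scaleN1r dotZl mulN1r. Qed.

Lemma dotBl x y z : dot (x - y) z = dot x z - dot y z.
Proof. by rewrite dotDl dotNl. Qed.

Lemma dotDr x y z : dot z (x + y) = dot z x + dot z y.
Proof. by rewrite dotC dotDl !(dotC _ z). Qed.

Lemma dotZr a x y : dot x (a *: y) = a * dot x y.
Proof. by rewrite dotC dotZl dotC. Qed.

Lemma dotNr x y : dot x (- y) = - dot x y.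
Proof. by rewrite dotC dotNl dotC. Qed.

Lemma dotBr x y z : dot z (x - y) = dot z x - dot z y.
Proof. by rewrite dotDr dotNr. Qed.

Definition dotE := (dotDl, dotDr, dotNl, dotNr, dotZl, dotZr).

Lemma dotxx_ge0 x : 0 <= dot x x.
Proof. by apply: sumr_ge0 => i _; rewrite -expr2 sqr_ge0. Qed.

Lemma dotxx_eq0 x : (dot x x == 0) = (x == 0).
Proof.
apply/idP/eqP => [|->]; last by rewrite /dot big1// => i _; rewrite mxE mul0r.
rewrite psumr_eq0 => [/allP h|i _]; last by rewrite -expr2 sqr_ge0.
apply/rowP => i; rewrite mxE; have /(_ (mem_index_enum i)) := h i.
by rewrite /= mulf_eq0 orbb => /eqP.
Qed.

Lemma enorm_ge0 x : 0 <= enorm x. Proof. exact: sqrtr_ge0. Qed.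

Lemma enorm_sqr x : enorm x ^+ 2 = dot x x.
Proof. by rewrite sqr_sqrtr// dotxx_ge0. Qed.

Lemma enorm_eq0 x : (enorm x == 0) = (x == 0).
Proof. by rewrite -(sqrf_eq0 (enorm x)) enorm_sqr dotxx_eq0. Qed.

Lemma enormZ a x : enorm (a *: x) = `|a| * enorm x.
Proof.
by rewrite /enorm dotZl dotZr mulrA -expr2 sqrtrM ?sqr_ge0// sqrtr_sqr.
Qed.

Lemma ler_enorm_sqr x y : (enorm x <= enorm y) = (dot x x <= dot y y).
Proof. by rewrite ler_sqrt// ?dotxx_ge0. Qed.

(** Cauchy-Schwarz, from the nonnegative square of [dot x x *: y - dot x y *: x]. *)
Lemma dot_le_enorm x y : `|dot x y| <= enorm x * enorm y.
Proof.
rewrite -(@ler_pXn2r _ 2)// ?nnegrE ?mulr_ge0 ?enorm_ge0//.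
rewrite exprMn !enorm_sqr real_normK ?num_real//.
have [->|x0] := eqVneq x 0.
  by rewrite -(scale0r 0) !dotZl !mul0r expr2 mul0r.
have xx : 0 < dot x x by rewrite lt_def dotxx_eq0 x0 dotxx_ge0.
have := dotxx_ge0 (dot x x *: y - dot x y *: x).
rewrite !dotE (dotC y x) => h.
by rewrite -(ler_pM2l xx); nra.
Qed.

Lemma enormD x y : enorm (x + y) <= enorm x + enorm y.
Proof.
rewrite -(@ler_pXn2r _ 2)// ?nnegrE ?addr_ge0 ?enorm_ge0//.
rewrite sqrrD !enorm_sqr !dotE (dotC y x).
have := le_trans (ler_norm _) (dot_le_enorm x y); lra.
Qed.

Lemma sphereE x : sphere R n x <-> dot x x = 1.
Proof.
rewrite /sphere/= -enorm_sqr; split => [->|/eqP]; first by rewrite expr1n.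
by rewrite -subr_eq0 subr_sqr_1 mulf_eq0 subr_eq0 paddr_eq0 ?enorm_ge0// oner_eq0
  andbF orbF => /eqP.
Qed.

Lemma sphere_enorm x : sphere R n x -> enorm x = 1. Proof. by []. Qed.

Lemma dot_sphere_itv x y : sphere R n x -> sphere R n y -> -1 <= dot x y <= 1.
Proof.
move=> /sphere_enorm x1 /sphere_enorm y1.
by rewrite -ler_norml (le_trans (dot_le_enorm x y))// x1 y1 mulr1.
Qed.

Lemma dot_distE x y : sphere R n x -> sphere R n y ->
  dot (x - y) (x - y) = 2 * (1 - dot x y).
Proof. move=> /sphereE x1 /sphereE y1; rewrite !dotE x1 y1 (dotC y x); ring. Qed.

Lemma dot_sphere_eq1 x y : sphere R n x -> sphere R n y ->
  (dot x y == 1) = (x == y).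
Proof.
move=> xS yS; rewrite -[RHS]subr_eq0 -dotxx_eq0 dot_distE// mulf_eq0 pnatr_eq0/=.
by rewrite subr_eq0 eq_sym.
Qed.

Lemma dot_sphere_lt1 x y : sphere R n x -> sphere R n y -> x != y -> dot x y < 1.
Proof.
move=> xS yS xy; rewrite lt_def eq_sym dot_sphere_eq1// xy/=.
by have /andP[] := dot_sphere_itv xS yS.
Qed.

(** For a unit vector [v], the mirror image of [x] in the hyperplane orthogonal to [v]. *)
Definition refl v x := x - (2 * dot x v) *: v.

Lemma reflK v : sphere R n v -> involutive (refl v).
Proof.
move=> /sphereE v1 x; rewrite /refl !dotE v1 mulr1.
have -> : 2 * (dot x v - 2 * dot x v) = - (2 * dot x v) by ring.
by rewrite scaleNr opprK subrK.
Qed.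

Lemma dot_refl v x y : sphere R n v -> dot (refl v x) (refl v y) = dot x y.
Proof. move=> /sphereE v1; rewrite /refl !dotE v1 (dotC v y); ring. Qed.

Lemma dot_refll v x y : sphere R n v -> dot (refl v x) y = dot x (refl v y).
Proof. by move=> vS; rewrite -{1}(reflK vS y) dot_refl. Qed.

Lemma dot_reflr v x y : dot x (refl v y) = dot x y - 2 * dot x v * dot y v.
Proof. by rewrite /refl !dotE; ring. Qed.

Lemma dot_refl_axis v x : sphere R n v -> dot (refl v x) v = - dot x v.
Proof. move=> /sphereE v1; rewrite /refl !dotE v1; ring. Qed.

Lemma refl_sphere v x : sphere R n v -> sphere R n (refl v x) <-> sphere R n x.
Proof. by move=> vS; rewrite !sphereE dot_refl. Qed.

Lemma refl_id v x : dot x v = 0 -> refl v x = x.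
Proof. by rewrite /refl => ->; rewrite mulr0 scale0r subr0. Qed.

Lemma reflB v x y : refl v (x - y) = refl v x - refl v y.
Proof.
by apply/rowP => i; rewrite /refl dotBl !mxE; ring.
Qed.

Lemma enorm_refl v x : sphere R n v -> enorm (refl v x) = enorm x.
Proof. by move=> vS; rewrite /enorm dot_refl. Qed.

Lemma enorm_reflB v x y : sphere R n v ->
  enorm (refl v x - refl v y) = enorm (x - y).
Proof. by move=> vS; rewrite -reflB enorm_refl. Qed.

Lemma reflNl v x : refl (- v) x = refl v x.
Proof. by rewrite /refl dotNr mulrN scaleNr scalerN opprK. Qed.

Lemma sphereN v : sphere R n (- v) <-> sphere R n v.
Proof. by rewrite !sphereE dotNl dotNr opprK. Qed.

(** The mirror is the bisecting hyperplane of [y] and [z], with normal [y - z]. *)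
Lemma exists_refl y z : sphere R n y -> sphere R n z -> y != z ->
  exists2 v, sphere R n v & refl v y = z.
Proof.
move=> yS zS yz.
have d0 : enorm (y - z) != 0 by rewrite enorm_eq0 subr_eq0.
have dE := enorm_sqr (y - z); rewrite dot_distE// in dE.
exists ((enorm (y - z))^-1 *: (y - z)).
  by rewrite /sphere/= enormZ ger0_norm ?invr_ge0 ?enorm_ge0// mulVf.
rewrite /refl scalerA dotZr dotBr (sphereE y).1//.
have -> : 2 * ((enorm (y - z))^-1 * (1 - dot y z)) / enorm (y - z) = 1.
  rewrite -[1 - _]mul1r -[X in X * (1 - _)](@mulVf _ 2) ?pnatr_eq0// -[_ * 2 * _]mulrA -dE.
  by field.
by rewrite scale1r opprB addrC subrK.
Qed.

(** Changing the axis alters both the coefficient [2 * dot x v] and the direction of the correction;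
    each change costs at most [2 * enorm (v - w)]. *)
Lemma enorm_refl_axis v w x : sphere R n v -> sphere R n w -> sphere R n x ->
  enorm (refl v x - refl w x) <= 4 * enorm (v - w).
Proof.
move=> vS wS xS.
have -> : refl v x - refl w x =
    (- 2 * dot x v) *: (v - w) + (- 2 * dot x (v - w)) *: w.
  apply/rowP => i; rewrite /refl dotBr !mxE; ring.
apply: le_trans (enormD _ _) _; rewrite !enormZ !normrM normrN (@ger0_norm _ 2)// -!mulrA.
rewrite (sphere_enorm wS) mulr1.
have := dot_le_enorm x (v - w); have := dot_le_enorm x v.
rewrite (sphere_enorm xS) (sphere_enorm vS) !mul1r => h1 h2.
have := ler_wpM2r (enorm_ge0 (v - w)) h1; rewrite ?mul1r; lra.
Qed.

End dot_theory.

(** * Hausdorff measure under Lipschitz maps *)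

Section hausdorff_lipschitz.
Context {R : realType} {n : nat}.
Implicit Types (A B : set 'rV[R]_n.+1) (phi : 'rV[R]_n.+1 -> 'rV[R]_n.+1).
Local Open Scope ereal_scope.

Lemma le_ediam A B : A `<=` B -> ediam A <= ediam B.
Proof.
by move=> AB; apply: ereal_sup_le => _ [xy [/AB ? /AB ?] <-]; exists xy.
Qed.

Lemma ediam_lipschitz phi (L : R) A : (0 < L)%R ->
  (forall x y, A x -> A y -> (enorm (phi x - phi y) <= L * enorm (x - y))%R) ->
  ediam (phi @` A) <= L%:E * ediam A.
Proof.
move=> L0 lip; apply: ge_ereal_sup => _ [_ [[x Ax <-] [y Ay <-]] <-] /=.
apply: (@le_trans _ _ (L%:E * (enorm (x - y))%:E)).
  by rewrite -EFinM lee_fin lip.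
by rewrite lee_pmul2l//; apply: ereal_sup_ubound; exists (x, y).
Qed.

Lemma hausdorff_weight_lipschitz k phi (L : R) A : (0 < L)%R ->
  (forall x y, A x -> A y -> (enorm (phi x - phi y) <= L * enorm (x - y))%R) ->
  hausdorff_weight k (phi @` A) <= (L ^+ k)%:E * hausdorff_weight k A.
Proof.
move=> L0 lip; have Lk : (0 <= L ^+ k)%R by rewrite exprn_ge0// ltW.
rewrite {2}/hausdorff_weight; case: eqP => [->|/eqP/set0P A0].
  by rewrite image_set0 hausdorff_weight0 mule0.
have phiA0 : phi @` A !=set0 by case: A0 => x Ax; exists (phi x), x.
rewrite /hausdorff_weight; case: eqP => [pA|_].
  by rewrite pA in phiA0; case: phiA0.
rewrite muleCA lee_wpmul2l//.
  by rewrite lee_fin divr_ge0 ?ball_volume_ge0.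
have A_ge0 := ediam_ge0 A0; have := ediam_lipschitz L0 lip.
elim: k {Lk} => [|k ih] le1; first by rewrite mul1e.
rewrite !expeS exprS EFinM muleACA; apply: lee_pmul => //; last exact: ih.
  exact: ediam_ge0.
by rewrite expe_ge0// ediam_ge0.
Qed.

(** Pieces of diameter at most [d / L] covering [A] are sent by [phi] to pieces of diameter at most
    [d], and their weights grow at most by [L ^+ k]. Each piece is first cut down to [A], the only
    place where [phi] is assumed Lipschitz. *)
Lemma hausdorff_outer_lipschitz k phi (L : R) A : (0 < L)%R ->
  (forall x y, A x -> A y -> (enorm (phi x - phi y) <= L * enorm (x - y))%R) ->
  hausdorff_outer k (phi @` A) <= (L ^+ k)%:E * hausdorff_outer k A.
Proof.
move=> L0 lip; have Lk : (0 < L ^+ k)%R by rewrite exprn_gt0.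
apply: ge_ereal_sup => _ [d /= d0 <-].
apply: (@le_trans _ _ ((L ^+ k)%:E * hausdorff_delta k (d / L) A)); last first.
  by rewrite lee_pmul2l// hausdorff_delta_le// divr_gt0.
rewrite -lee_pdivrMl//; apply: le_ereal_inf_tmp => _ [F [dF AF] <-].
rewrite lee_pdivrMl//.
pose G i := phi @` (F i `&` A).
have lipG i : forall x y, (F i `&` A) x -> (F i `&` A) y ->
    (enorm (phi x - phi y) <= L * enorm (x - y))%R.
  by move=> x y [_ Ax] [_ Ay]; exact: lip.
apply: (@le_trans _ _ (\sum_(i <oo) hausdorff_weight k (G i))).
  apply: ereal_inf_lbound; exists G => //; split => [i|_ [x Ax <-]].
    apply: le_trans (ediam_lipschitz L0 (lipG i)) _.
    apply: (@le_trans _ _ (L%:E * (d / L)%:E)).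
      by rewrite lee_pmul2l// (le_trans _ (dF i))// le_ediam.
    by rewrite -EFinM lee_fin mulrCA divff ?mulr1// gt_eqF.
  by have [i _ Fx] := AF _ Ax; exists i => //; exists x.
rewrite -nneseriesZl//; last by move=> *; exact: hausdorff_weight_ge0.
apply: lee_nneseries => [i *|i *]; first exact: hausdorff_weight_ge0.
apply: le_trans (hausdorff_weight_lipschitz k L0 (lipG i)) _.
rewrite lee_pmul2l// /hausdorff_weight; case: eqP => [FA0|/eqP/set0P FA0].
  exact: hausdorff_weight_ge0.
case: eqP => [F0|_]; first by move: FA0; rewrite F0 set0I => -[].
rewrite lee_wpmul2l//; first by rewrite lee_fin divr_ge0 ?ball_volume_ge0.
have := le_ediam (@subIsetl _ (F i) A); have := ediam_ge0 FA0.
elim: k {Lk} => [//|k ih] h1 h2.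
by rewrite !expeS; apply: lee_pmul => //; [rewrite expe_ge0|exact: ih].
Qed.

End hausdorff_lipschitz.

(** * Reflection invariance and a finiteness criterion for the Hausdorff measure *)

Section hausdorff_finite.
Context {R : realType} {n : nat}.
Implicit Types (A : set 'rV[R]_n.+1).
Local Open Scope ereal_scope.

(** A reflection is 1-Lipschitz, which gives one inequality; applied to the image, with [reflK], it
    gives the other. *)
Lemma hausdorff_outer_refl k v A : sphere R n v ->
  hausdorff_outer k (refl v @` A) = hausdorff_outer k A.
Proof.
move=> vS; have le1 B : hausdorff_outer k (refl v @` B) <= hausdorff_outer k B.
  rewrite -[leRHS]mul1e -(expr1n R k); apply: hausdorff_outer_lipschitz => //.
  by move=> x y _ _; rewrite enorm_reflB// mul1r.
apply/eqP; rewrite eq_le le1/= -{1}(image_id A).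
rewrite (_ : [set _ | _ in A] = refl v @` (refl v @` A)) ?le1//.
by rewrite image_comp; apply: eq_imagel => x _ /=; rewrite reflK.
Qed.

Lemma hausdorff_weight_le k A (d : R) : (0 <= d)%R -> ediam A <= d%:E ->
  hausdorff_weight k A <= (ball_volume R k / 2 ^+ k * d ^+ k)%:E.
Proof.
move=> d0 Ad; have w0 : (0 <= ball_volume R k / 2 ^+ k)%R.
  by rewrite divr_ge0 ?ball_volume_ge0.
rewrite /hausdorff_weight; case: eqP => [_|/eqP/set0P A0].
  by rewrite lee_fin mulr_ge0// exprn_ge0.
rewrite [leRHS]EFinM lee_wpmul2l// EFin_expe.
elim: k {w0} => [//|k ih]; rewrite !expeS; apply: lee_pmul => //.
  exact: ediam_ge0.
by rewrite expe_ge0// ediam_ge0.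
Qed.

(** At scale [D / m] at most [M * m ^+ k] pieces each weigh at most a constant times [(D / m) ^+ k]:
    the powers of [m] cancel and the bound is uniform in the scale. *)
Lemma hausdorff_outer_lty k A (D M : R) : (0 <= D)%R -> (0 <= M)%R ->
  (forall m, (0 < m)%N -> exists (T : finType) (P : T -> set 'rV[R]_n.+1),
    [/\ (#|T|%:R <= M * m%:R ^+ k)%R, A `<=` \bigcup_t P t &
        forall t, ediam (P t) <= (D / m%:R)%:E]) ->
  hausdorff_outer k A < +oo.
Proof.
move=> D0 M0 H; pose w := (ball_volume R k / 2 ^+ k)%R.
have w0 : (0 <= w)%R by rewrite divr_ge0 ?ball_volume_ge0.
apply: (@le_lt_trans _ _ (w * D ^+ k * M)%:E); last exact: ltry.
apply: ge_ereal_sup => _ [d /= d0 <-].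
pose m := (Num.truncn (D / d)).+1.
have m0 : (0 < m%:R :> R)%R by rewrite ltr0n.
have Dmd : (D / m%:R <= d)%R.
  by rewrite ler_pdivrMr// mulrC -ler_pdivrMr// ltW// truncnS_gt.
have [//|T [P [cardT AP dP]]] := H m.
(* The finite family becomes a sequence by padding its enumeration with empty sets, which weigh
   nothing. *)
pose F i := nth set0 (map P (enum T)) i.
have Fge i : (#|T| <= i)%N -> F i = set0.
  by move=> Ti; rewrite /F nth_default// size_map -cardE.
have Flt i : F i = set0 \/ exists t, F i = P t.
  have [/Fge|iT] := leqP #|T| i; [by left|right].
  have [t0 _] : exists t0 : T, t0 \in enum T.
    by case: (enum T) (cardE T) iT => [->//|t s _ _]; exists t; rewrite inE eqxx.
  by exists (nth t0 (enum T) i); rewrite /F (nth_map t0)// -cardE.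
have Fd i : ediam (F i) <= (D / m%:R)%:E.
  by have [->|[t ->]] := Flt i; rewrite ?ediam_set0 ?leNye.
apply: (@le_trans _ _ (\sum_(i <oo) hausdorff_weight k (F i))).
  apply: ereal_inf_lbound; exists F => //; split => [i|x /AP[t _ Ptx]].
    by rewrite (le_trans (Fd i))// lee_fin.
  exists (index t (enum T)) => //.
  by rewrite /F (nth_map t) ?index_mem ?mem_enum// nth_index ?mem_enum.
have Dm0 : (0 <= D / m%:R)%R by rewrite divr_ge0// ltW.
have wd0 : (0 <= w * (D / m%:R) ^+ k)%R by rewrite mulr_ge0// exprn_ge0.
apply: lime_le.
  by apply: is_cvg_nneseries => *; exact: hausdorff_weight_ge0.
apply: nearW => N.
apply: (@le_trans _ _ (#|T|%:R * (w * (D / m%:R) ^+ k))%:E); last first.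
  rewrite lee_fin; apply: le_trans (ler_wpM2r wd0 cardT) _.
  rewrite expr_div_n le_eqVlt; apply/orP; left; apply/eqP.
  have : (m%:R ^+ k != 0 :> R)%R by rewrite expf_neq0// gt_eqF.
  by move: (m%:R ^+ k)%R => z z0; field.
(* Only the first [#|T|] terms can have positive weight. *)
apply: (@le_trans _ _ (((minn N #|T|)%:R * (w * (D / m%:R) ^+ k))%:E)).
  elim: N => [|N ih]; first by rewrite big_nil min0n mul0r.
  rewrite big_nat_recr//=; have [TN|NT] := leqP #|T| N.
    rewrite Fge// hausdorff_weight0 adde0 (le_trans ih)//.
    by rewrite (minn_idPr TN) (minn_idPr (leqW TN)).
  rewrite (minn_idPl NT) -natr1 mulrDl mul1r EFinD leeD//; last first.
    exact: hausdorff_weight_le.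
  by rewrite (minn_idPl (ltnW NT)) in ih.
by rewrite lee_fin ler_wpM2r// ler_nat geq_minr.
Qed.

End hausdorff_finite.

(** * Finite area of the sphere *)

Section sphere_finite.
Context {R : realType} {n : nat}.

Lemma enorm_le_sum (x : 'rV[R]_n.+1) : enorm x <= \sum_i `|x 0 i|.
Proof.
rewrite -(@ler_pXn2r _ 2)// ?nnegrE ?enorm_ge0 ?sumr_ge0// enorm_sqr expr2 mulr_suml.
apply: ler_sum => i _; rewrite -expr2 -real_normK ?num_real// expr2 ler_wpM2l//.
by rewrite (bigD1 i)//= lerDl sumr_ge0.
Qed.

Lemma sphere_coord_le1 (x : 'rV[R]_n.+1) i : sphere R n x -> `|x 0 i| <= 1.
Proof.
move=> /sphereE; rewrite /dot (bigD1 i)//= => xE.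
rewrite -(@ler_pXn2r _ 2)// ?nnegrE// real_normK ?num_real// expr1n -xE expr2.
by rewrite lerDl sumr_ge0// => j _; rewrite -expr2 sqr_ge0.
Qed.

Lemma sphere_coord_large (x : 'rV[R]_n.+1) : sphere R n x ->
  exists i, n.+1%:R^-1 <= `|x 0 i|.
Proof.
move=> /sphereE xE; apply/existsP; apply: contraT.
rewrite negb_exists => /forallP small.
have : dot x x < 1; last by rewrite xE ltxx.
apply: (@lt_le_trans _ _ (\sum_(i < n.+1) n.+1%:R^-1)); last first.
  by rewrite sumr_const card_ord -[_ *+ _]mulr_natr mulVf.
apply: ltr_sum => [|i _]; first by apply/hasP; exists ord0; rewrite ?mem_index_enum.
have := small i; rewrite -ltNge -expr2 -real_normK ?num_real// => xi.
rewrite expr2 -[ltRHS]mulr1; apply: ltr_pM => //.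
by rewrite (lt_le_trans xi)// invf_le1// ler1n.
Qed.

(** A cell fixes a coordinate of absolute value at least [n.+1%:R^-1], its sign, and a box of side
    [m%:R^-1] for the other coordinates; there the sphere is a Lipschitz graph. Coordinates shifted
    by 1 run through the closed interval [0, 2], whose right end needs the extra index [2 * m]. *)
Definition sphere_cell (m : nat) (t : 'I_n.+1 * bool * {ffun 'I_n -> 'I_(2 * m).+1}) :=
  [set x : 'rV[R]_n.+1 | [/\ sphere R n x, n.+1%:R^-1 <= `|x 0 t.1.1|,
     (if t.1.2 then 0 <= x 0 t.1.1 else x 0 t.1.1 <= 0) &
     forall j, (t.2 j)%:R <= (x 0 (lift t.1.1 j) + 1) * m%:R <= (t.2 j).+1%:R]].

(** The [n] box coordinates differ by at most 1/m each. Subtracting the two sphere equations bounds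
    the difference of the squares of the large coordinate; dividing by the sum of its two values, at
    least 2/(n+1) in absolute value, gives n(n+1)/m. The total is n(n+2)/m. *)
Lemma sphere_cell_dist m t x y : (0 < m)%N ->
  @sphere_cell m t x -> @sphere_cell m t y ->
  enorm (x - y) <= (n * n.+2)%:R / m%:R.
Proof.
case: t => -[i b] c m0 [/= xS xi xb xc] [/= yS yi yb yc].
have m0' : 0 < m%:R :> R by rewrite ltr0n.
have dj j : `|x 0 (lift i j) - y 0 (lift i j)| <= m%:R^-1.
  rewrite -[leRHS]mul1r ler_pdivlMr// -[X in _ * X]gtr0_norm// -normrM ler_norml.
  move: (xc j) (yc j); rewrite -natr1 => /andP[h1 h2] /andP[h3 h4].
  by apply/andP; split; lra.
have di : `|x 0 i - y 0 i| <= (n * n.+1)%:R / m%:R.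
  have sq : (x 0 i - y 0 i) * (x 0 i + y 0 i) =
      \sum_j (y 0 (lift i j) - x 0 (lift i j)) * (y 0 (lift i j) + x 0 (lift i j)).
    have := (sphereE y).1 yS; have := (sphereE x).1 xS.
    rewrite /dot (bigD1_ord i)//= => xE; rewrite (bigD1_ord i)//= => yE.
    have -> : \sum_j (y 0 (lift i j) - x 0 (lift i j)) *
        (y 0 (lift i j) + x 0 (lift i j)) =
        \sum_j (y 0 (lift i j) * y 0 (lift i j)) -
        \sum_j (x 0 (lift i j) * x 0 (lift i j)).
      by rewrite -sumrB; apply: eq_bigr => j _; ring.
    move: xE yE; set X := \sum_j _; set Y := \sum_j _ => xE yE.
    have -> : (x 0 i - y 0 i) * (x 0 i + y 0 i) = x 0 i * x 0 i - y 0 i * y 0 i by ring.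
    lra.
  have large : 2 * n.+1%:R^-1 <= `|x 0 i + y 0 i|.
    suff -> : `|x 0 i + y 0 i| = `|x 0 i| + `|y 0 i| by rewrite mulr2n mulrDl mul1r lerD.
    case: b xb yb => xb yb; first by rewrite !ger0_norm ?addr_ge0.
    by rewrite !ler0_norm ?opprD// -oppr_ge0 opprD addr_ge0 ?oppr_ge0.
  have small : `|x 0 i - y 0 i| * `|x 0 i + y 0 i| <= n%:R * (m%:R^-1 * 2).
    rewrite -normrM sq (le_trans (ler_norm_sum _ _ _))//.
    apply: (@le_trans _ _ (\sum_(j < n) m%:R^-1 * 2)); last first.
      by rewrite sumr_const card_ord -[_ *+ _]mulr_natl.
    apply: ler_sum => j _; rewrite normrM ler_pM//; first by rewrite distrC.
    rewrite (le_trans (ler_normD _ _))// (natrD _ 1 1) lerD// sphere_coord_le1//.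
  have := ler_wpM2l (normr_ge0 (x 0 i - y 0 i)) large => h.
  have := le_trans h small; rewrite mulrCA [leRHS]mulrA [leRHS]mulrC ler_pM2l// ler_pdivrMr//.
  by rewrite natrM => /le_trans; apply; rewrite mulrAC.
apply: le_trans (enorm_le_sum _) _; rewrite (bigD1_ord i)//= !mxE.
apply: (@le_trans _ _ ((n * n.+1)%:R / m%:R + \sum_(j < n) m%:R^-1)).
  by apply: lerD => //; apply: ler_sum => j _; rewrite !mxE dj.
rewrite sumr_const card_ord -(mulr_natl m%:R^-1) -mulrDl -natrD.
apply: ler_wpM2r; first by rewrite invr_ge0 ltW.
by rewrite ler_nat; lia.
Qed.

Lemma sphere_finite : (hausdorff n (sphere R n) < +oo)%E.
Proof.
apply: (@hausdorff_outer_lty _ _ _ _ (n * n.+2)%:R (2 * n.+1 * 3 ^ n)%:R) => // m m0.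
exists ('I_n.+1 * bool * {ffun 'I_n -> 'I_(2 * m).+1})%type, (@sphere_cell m); split.
(* There are 2(n+1)(2m+1)^n cells, and 2m+1 is at most 3m. *)
- rewrite !card_prod card_bool card_ord card_ffun !card_ord -natrX -natrM ler_nat.
  rewrite -(mulnA (2 * n.+1)%N) -expnMn (mulnC n.+1) leq_mul2l/=.
  by case: (n) => [//|n']; rewrite leq_exp2r//; lia.
- move=> x xS; have [i xi] := sphere_coord_large xS.
  have m0' : 0 < m%:R :> R by rewrite ltr0n.
  have lo j : 0 <= (x 0 (lift i j) + 1) * m%:R.
    have := sphere_coord_le1 (lift i j) xS; rewrite ler_norml => /andP[h _].
    by apply: mulr_ge0; [lra|exact: ltW].
  exists (i, 0 <= x 0 i, [ffun j => inord (Num.truncn ((x 0 (lift i j) + 1) * m%:R))]) => //.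
  split => //=.
    by case: ifPn => //; rewrite -ltNge => /ltW.
  move=> j; rewrite ffunE inordK.
    by rewrite truncn_le lo/= ltW// truncnS_gt.
  rewrite ltnS -(ler_nat R).
  apply: (@le_trans _ _ ((x 0 (lift i j) + 1) * m%:R)); first by rewrite truncn_le lo.
  rewrite natrM ler_pM2r//.
  have := sphere_coord_le1 (lift i j) xS; rewrite ler_norml => /andP[_]; lra.
- move=> t; apply: ge_ereal_sup => _ [[x y] [/= xP yP] <-].
  by rewrite lee_fin (sphere_cell_dist m0 xP yP).
Qed.

End sphere_finite.

(** * Borel measurability of vector operations *)

Section borel_measurability.
Context {R : realType} {n : nat}.
Local Notation E := (borel R n).

Lemma open_borel_measurable (U : set 'rV[R]_n.+1) : open U -> measurable (U : set E).
Proof. exact: sub_sigma_algebra. Qed.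

Lemma measurable_coord i : measurable_fun [set: E] (fun x : E => (x : 'rV[R]_n.+1) 0 i : R).
Proof.
apply: (measurability _ (RGenOInfty.measurableE R)).
move=> _ [_ [a ->] <-]; apply: measurableI => //; apply: open_borel_measurable.
apply: (@open_comp _ _ (fun x : 'rV[R]_n.+1 => x 0 i)).
  by move=> x _; exact: coord_continuous.
by rewrite set_itvE; exact: open_gt.
Qed.

Lemma rat_approx (x c : R) : 0 < c -> {q : rat | `|x - ratr q| < c}.
Proof.
move=> c0; apply: cid; have /rat_in_itvoo[r] : x - c < x + c by lra.
rewrite in_itv/= => /andP[h1 h2]; exists r.
by rewrite ltr_norml; apply/andP; split; lra.
Qed.

(* The rational boxes form a countable base of the topology. *)
Lemma measurable_borelP d (T : measurableType d) (f : T -> E) :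
  (forall i, measurable_fun [set: T] (fun t => (f t : 'rV[R]_n.+1) 0 i : R)) ->
  measurable_fun [set: T] f.
Proof.
move=> mf; apply: (@measurability _ _ T E setT f (@open 'rV[R]_n.+1)) => //.
move=> _ [U oU <-]; rewrite setTI.
pose box (p : {ffun 'I_n.+1 -> rat} * nat) :=
  [set x : 'rV[R]_n.+1 | forall i, `|x 0 i - ratr (p.1 i)| < p.2.+1%:R^-1].
pose V p : set T := if `[< box p `<=` U >] then f @^-1` box p else set0.
have -> : f @^-1` U = \bigcup_p V p.
  apply/seteqP; split=> [t /= Uft|t [p _]]; last first.
    by rewrite /V; case: asboolP => // pU /pU.
  have [e /= e0 eU] : exists2 e : R, 0 < e & forall y : 'rV[R]_n.+1, `|f t - y| < e -> U y.
    have /nbhs_ballP[e /= e0 eU] : nbhs (f t : 'rV[R]_n.+1) U by exact: open_nbhs_nbhs.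
    by exists e => // y yt; apply: eU; rewrite -ball_normE.
  pose m := Num.truncn (2 / e).
  have me : m.+1%:R^-1 < e / 2.
    by rewrite -[ltRHS]invf_div ltf_pV2 ?posrE ?ltr0n ?divr_gt0// truncnS_gt.
  have m0 : 0 < m.+1%:R^-1 :> R by rewrite invr_gt0.
  pose q i := rat_approx ((f t : 'rV[R]_n.+1) 0 i) m0.
  exists ([ffun i => sval (q i)], m) => //.
  rewrite /V; case: asboolP => [_|]; first by move=> i /=; rewrite ffunE; exact: svalP (q i).
  case=> y yb; apply: eU; rewrite [ltLHS]/Num.Def.normr/= mx_normrE.
  apply/bigmax_ltP; split => // -[j i] _; rewrite (ord1 j) !mxE/=.
  have := yb i; rewrite /= ffunE -/m; have := svalP (q i).
  move: (ratr _) => z.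
  move: (m.+1%:R^-1) me => c ce; rewrite !ltr_norml => /andP[h1 h2] /andP[h3 h4].
  by apply/andP; split; lra.
apply: countable_bigcupT_measurable => [|p]; first exact: countableP.
rewrite /V; case: asboolP => [_|//].
have -> : f @^-1` box p = \bigcap_(i in [set: 'I_n.+1])
    (fun t => `|(f t : 'rV[R]_n.+1) 0 i - ratr (p.1 i)| < p.2.+1%:R^-1) @^-1` [set true].
  by apply/seteqP; split => [t h i _ /=|t h i]; [exact: h|exact: (h i Logic.I)].
rewrite bigcap_fset_set//=; apply: bigsetI_measurable => i _; rewrite -[X in measurable X]setTI.
apply: measurable_fun_ltr => //; apply: measurableT_comp => //.
by apply: measurable_funB.
Qed.

Lemma measurable_dot d (T : measurableType d) (f g : T -> E) :
  measurable_fun [set: T] f -> measurable_fun [set: T] g ->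
  measurable_fun [set: T] (fun t => dot (f t) (g t)).
Proof.
move=> mf mg; apply: measurable_sum => i; apply: measurable_funM;
  by apply: (measurableT_comp (measurable_coord i)).
Qed.

Lemma measurable_enorm d (T : measurableType d) (f : T -> E) :
  measurable_fun [set: T] f -> measurable_fun [set: T] (fun t => enorm (f t)).
Proof.
move=> mf; apply: (measurableT_comp (f := @Num.sqrt R)); last exact: measurable_dot.
by apply: continuous_measurable_fun; exact: sqrt_continuous.
Qed.

Lemma measurable_lin d (T : measurableType d) (f g : T -> E) (a b : T -> R) :
  measurable_fun [set: T] f -> measurable_fun [set: T] g ->
  measurable_fun [set: T] a -> measurable_fun [set: T] b ->
  measurable_fun [set: T] (fun t => a t *: (f t : 'rV[R]_n.+1) + b t *: (g t : 'rV[R]_n.+1) : E).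
Proof.
move=> mf mg ma mb; apply: measurable_borelP => i.
rewrite (_ : (fun t => _) =
  (fun t => a t * (f t : 'rV[R]_n.+1) 0 i + b t * (g t : 'rV[R]_n.+1) 0 i)).
  by apply: measurable_funD; apply: measurable_funM => //;
    apply: (measurableT_comp (measurable_coord i)).
by apply/funext => t; rewrite !mxE.
Qed.

Lemma measurable_refl2 : measurable_fun [set: E * E] (fun vx : E * E => refl vx.1 vx.2 : E).
Proof.
rewrite (_ : (fun _ => _) = (fun vx : E * E => 1 *: (vx.2 : 'rV[R]_n.+1) +
    (- (2 * dot vx.2 vx.1)) *: (vx.1 : 'rV[R]_n.+1) : E)).
  apply: measurable_lin => //; apply: measurableT_comp => //.
  by apply: measurable_funM => //; exact: measurable_dot.
by apply/funext => vx; rewrite scale1r scaleNr.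
Qed.

Lemma measurable_refl (v : E) : measurable_fun [set: E] (refl v : E -> E).
Proof.
apply: (measurableT_comp (f := fun vx : E * E => refl vx.1 vx.2 : E) (g := fun x : E => (v, x))).
  exact: measurable_refl2.
exact: measurable_fun_pair.
Qed.

Lemma measurable_sphere : measurable (sphere R n).
Proof.
rewrite -[X in measurable X]setTI (_ : sphere R n = (fun x : E => dot x x) @^-1` [set 1]).
  by apply: measurable_dot.
by apply/seteqP; split => x /= /sphereE.
Qed.

Lemma measurable_refl_preimage (v : E) (A : set E) : measurable A ->
  measurable (refl v @^-1` A : set E).
Proof. by move=> mA; rewrite -[X in measurable X]setTI; exact: measurable_refl. Qed.

End borel_measurability.

(** * Surface measure and double integrals over pairs of points *)

Lemma indic_ge0 (R : numDomainType) (T : Type) (A : set T) x : 0 <= \1_A x :> R.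
Proof. by rewrite indicE ler0n. Qed.

Section sphere_measure.
Context (R : realType) (n : nat).
Local Notation E := (borel R n).
Local Notation S := (sphere R n).
Local Open Scope ereal_scope.

(** On the whole space [hausdorff n] is not sigma-finite; its restriction to the sphere is a finite
    measure, suited to product measures and Tonelli. *)
Definition smeasure : set E -> \bar R :=
  mrestr (hausdorff n) (@measurable_sphere R n).

HB.instance Definition _ := Measure.on smeasure.

Let smeasure_fin : fin_num_fun smeasure.
Proof.
move=> A mA; rewrite ge0_fin_numE//; apply: (le_lt_trans _ (@sphere_finite R n)).
by rewrite /smeasure /mrestr le_hausdorff_outer.
Qed.

HB.instance Definition _ := Measure_isFinite.Build _ _ _ smeasure smeasure_fin.

Lemma smeasureE A : A `<=` S -> smeasure A = hausdorff n A.
Proof. by move=> AS; rewrite /smeasure /mrestr setIidl. Qed.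

Lemma smeasure_refl v A : S v -> smeasure (refl v @^-1` A) = smeasure A.
Proof.
move=> vS; rewrite /smeasure /mrestr -[RHS](hausdorff_outer_refl _ _ vS).
congr (hausdorff_outer _ _); apply/seteqP; split => [x [/= Ax xS]|_ [x [Ax xS] <-]].
  by exists (refl v x); [split; [|exact/refl_sphere]|rewrite reflK].
by split => /=; [rewrite reflK|exact/refl_sphere].
Qed.

Lemma integral_smeasure (A : set E) (f : E -> \bar R) : A `<=` S ->
  \int[smeasure]_(x in A) f x = \int[hausdorff n]_(x in A) f x.
Proof.
move=> AS; apply: eq_measure_integral => B mB BA.
by rewrite /= smeasureE//; exact: subset_trans BA AS.
Qed.

Definition pair_int (g : E * E -> R) :=
  \int[smeasure \x smeasure]_(z in S `*` S) (g z)%:E.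

Lemma measurable_SS : measurable (S `*` S).
Proof. by apply: measurableX; exact: measurable_sphere. Qed.

(** Tonelli turns the iterated integral that defines the fractional perimeter into one integral
    against the product measure. Since [k] only has to agree with [g] on the given sets, a kernel
    that is well behaved off the sphere may be substituted. *)
Lemma pair_int_iterated (A B : set E) (k : E -> E -> R) (g : E * E -> R) :
  measurable A -> measurable B -> A `<=` S -> B `<=` S ->
  measurable_fun [set: E * E] g -> (forall z, 0 <= g z)%R ->
  (forall x y, A x -> B y -> k x y = g (x, y)) ->
  \int[hausdorff n]_(x in A) \int[hausdorff n]_(y in B) (k x y)%:E =
  pair_int (fun z => \1_A z.1 * \1_B z.2 * g z)%R.
Proof.
move=> mA mB AS BS mg g0 kg.
have mh : measurable_fun [set: E * E] (fun z => \1_A z.1 * \1_B z.2 * g z)%R.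
  apply: measurable_funM => //; apply: measurable_funM;
    by apply: measurableT_comp => //; exact: measurable_indic.
have mhE : measurable_fun (S `*` S) (fun z => (\1_A z.1 * \1_B z.2 * g z)%:E).
  exact/measurable_funTS/measurable_EFinP.
have h0 z : (0 <= \1_A z.1 * \1_B z.2 * g z)%R.
  by apply: mulr_ge0; [apply: mulr_ge0; exact: indic_ge0|exact: g0].
rewrite /pair_int [RHS]integral_mkcond [RHS]fubini_tonelli1; last 2 first.
- exact: (measurable_restrictT _ measurable_SS).1 mhE.
- by move=> z; apply: erestrict_ge0 => *; rewrite lee_fin.
rewrite -(integral_smeasure _ AS) [LHS]integral_mkcond.
apply: eq_integral => x _.
rewrite /fubini_F [LHS]patchE; case: ifPn => xA; last first.
  rewrite integral0_eq// => y _; rewrite patchE; case: ifP => // _.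
  by rewrite !indicE (negbTE xA) !mul0r.
rewrite -(integral_smeasure _ BS) [LHS]integral_mkcond.
apply: eq_integral => y _.
rewrite !patchE; case: ifPn => yB; last first.
  by case: ifP => // _; rewrite !indicE (negbTE yB) mulr0 mul0r.
rewrite !inE in xA yB; rewrite mem_set; last by split; [exact: AS|exact: BS].
by rewrite kg// !indicE !mem_set// !mul1r.
Qed.

Lemma pair_int_le (g h : E * E -> R) :
  measurable_fun [set: E * E] g -> measurable_fun [set: E * E] h ->
  (forall z, 0 <= g z)%R -> (forall x y, S x -> S y -> g (x, y) <= h (x, y))%R ->
  pair_int g <= pair_int h.
Proof.
move=> mg mh g0 gh; apply: ge0_le_integral.
- exact: measurable_SS.
- by move=> *; rewrite lee_fin.
- exact/measurable_funTS/measurable_EFinP.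
- exact/measurable_funTS/measurable_EFinP.
- by move=> [x y] [/= xS yS]; rewrite lee_fin gh.
Qed.

Lemma eq_pair_int (g h : E * E -> R) :
  (forall x y, S x -> S y -> g (x, y) = h (x, y)) -> pair_int g = pair_int h.
Proof.
by move=> gh; apply: eq_integral => -[x y]; rewrite inE => -[/= xS yS]; rewrite gh.
Qed.

Lemma pair_intD (g h : E * E -> R) :
  measurable_fun [set: E * E] g -> measurable_fun [set: E * E] h ->
  (forall z, 0 <= g z)%R -> (forall z, 0 <= h z)%R ->
  pair_int (fun z => g z + h z)%R = pair_int g + pair_int h.
Proof.
move=> mg mh g0 h0; rewrite -ge0_integralD.
- by [].
- exact: measurable_SS.
- by move=> *; rewrite lee_fin.
- exact/measurable_funTS/measurable_EFinP.
- by move=> *; rewrite lee_fin.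
- exact/measurable_funTS/measurable_EFinP.
Qed.

Lemma pair_int_ge0 (g : E * E -> R) : (forall z, 0 <= g z)%R -> 0 <= pair_int g.
Proof. by move=> g0; apply: integral_ge0 => *; rewrite lee_fin. Qed.

Lemma pair_intZ (c : R) (g : E * E -> R) :
  (0 <= c)%R -> measurable_fun [set: E * E] g -> (forall z, 0 <= g z)%R ->
  pair_int (fun z => c * g z)%R = c%:E * pair_int g.
Proof.
move=> c0 mg g0; rewrite -ge0_integralZl.
- by [].
- exact: measurable_SS.
- exact/measurable_funTS/measurable_EFinP.
- by move=> *; rewrite lee_fin.
- by rewrite lee_fin.
Qed.

(** The push-forward of the product measure agrees with it on rectangles, hence everywhere by
    uniqueness of product measures. *)
Lemma pair_int_comp (phi psi : E -> E) (g : E * E -> R) :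
  measurable_fun [set: E] phi -> measurable_fun [set: E] psi ->
  (forall A, measurable A -> smeasure (phi @^-1` A) = smeasure A) ->
  (forall A, measurable A -> smeasure (psi @^-1` A) = smeasure A) ->
  (forall x, S (phi x) <-> S x) -> (forall x, S (psi x) <-> S x) ->
  measurable_fun [set: E * E] g -> (forall z, 0 <= g z)%R ->
  pair_int (fun z => g (phi z.1, psi z.2)) = pair_int g.
Proof.
move=> mphi mpsi iphi ipsi Sphi Spsi mg g0.
pose T (z : E * E) := (phi z.1, psi z.2).
have mT : measurable_fun [set: E * E] T.
  by apply: measurable_fun_pair; apply: measurableT_comp.
have TS : T @^-1` (S `*` S) = S `*` S.
  apply/seteqP; split => -[x y] [/= h1 h2]; split => /=;
    by [exact/Sphi|exact/Spsi].
transitivity (\int[pushforward (smeasure \x smeasure) T]_(z in S `*` S) (g z)%:E).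
  rewrite ge0_integral_pushforward ?TS//.
  - exact: measurable_SS.
  - exact/measurable_funTS/measurable_EFinP.
  - by move=> *; rewrite lee_fin.
apply: eq_measure_integral => A mA _.
apply: esym; apply: (@product_measure_unique _ _ _ _ _ smeasure smeasure
  (measure_function_pushforward__canonical__measure_function_Measure
    (smeasure \x smeasure)%type mT)) => //.
move=> X Y mX mY; rewrite /= /pushforward.
rewrite (_ : T @^-1` _ = (phi @^-1` X) `*` (psi @^-1` Y))//.
have mp f Z : measurable_fun [set: E] f -> measurable Z -> measurable (f @^-1` Z : set E).
  by move=> mf mZ; rewrite -[X in measurable X]setTI; exact: mf.
by rewrite product_measure1E; [congr (_ * _); [exact: iphi|exact: ipsi]|exact: mp|exact: mp].
Qed.

End sphere_measure.

(** * Polarization (two-point symmetrization) *)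

(** The finite case check behind polarization. The bits [e], [e'] record whether [x] and its mirror
    image belong to the set, [s], [s'] whether they lie on the positive side; [d], [d'], [t], [t']
    do the same for [y]. The kernel has value [a] at [x], [y] and at their two images, and [b] at
    one point and the image of the other. [T] sums over the four pairs and [P] polarizes. The
    alternatives with equal bits cover coinciding points, where the kernel is unconstrained. *)
Lemma four_point (R : realFieldType) (a b : R) (e e' d d' s s' t t' : bool) :
  ~~ (s && s') -> ~~ (t && t') -> s || s' || (e == e') -> t || t' || (d == d') ->
  (s && t || s' && t' -> b <= a \/ (e = d /\ e' = d')) ->
  (s && t' || s' && t -> a <= b \/ (e = d' /\ e' = d)) ->
  (~~ (s || s') || ~~ (t || t') -> a = b) ->
  let T (p p' q q' : bool) : R :=
    p%:R * (~~ q)%:R * a + p'%:R * (~~ q)%:R * b +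
    p%:R * (~~ q')%:R * b + p'%:R * (~~ q')%:R * a in
  let P (u e e' : bool) := if u then e || e' else e && e' in
  T (P s e e') (P s' e' e) (P t d d') (P t' d' d) +
    [&& e, ~~ e' & s]%:R * [&& ~~ d, d' & t]%:R * (a - b) <= T e e' d d'.
Proof.
case: e e' d d' => -[] [] []; case: s s' t t' => -[] [] [] //= _ _ _ _ h1 h2 h3;
  try lra;
  do ?[have {h1} := h1 isT => h1]; do ?[have {h2} := h2 isT => h2];
  do ?[have {h3} := h3 isT => h3];
  first [lra | by case: h1 => [h1|[? ?]]; [lra|] | by case: h2 => [h2|[? ?]]; [lra|]].
Qed.

Section polarization.
Context (R : realType) (n : nat).
Local Notation E := (borel R n).
Local Notation S := (sphere R n).
Local Notation mu := (@smeasure R n).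
Implicit Types (A : set E) (v : E).

Definition polar v A : set E :=
  [set x | (A x /\ A (refl v x)) \/ (0 < dot x v /\ (A x \/ A (refl v x)))].

(* The points of the positive side where the polarization keeps, respectively
   swaps, the two points of the pair [x, refl v x]. *)
Definition kept v A : set E := [set x | [/\ A x, ~ A (refl v x) & 0 < dot x v]].
Definition swapped v A : set E := [set x | [/\ ~ A x, A (refl v x) & 0 < dot x v]].

Lemma measurable_pos v : measurable ([set x | 0 < dot x v] : set E).
Proof.
rewrite -[X in measurable X]setTI.
have -> : [set x : E | 0 < dot x v] = (fun x : E => 0 < dot x v) @^-1` [set true] by [].
apply: measurable_fun_ltr => //; exact: measurable_dot.
Qed.

Lemma measurable_polar v A : measurable A -> measurable (polar v A).
Proof.
move=> mA; have mr := measurable_refl_preimage v mA; have mp := measurable_pos v.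
rewrite (_ : polar v A = (A `&` refl v @^-1` A) `|`
  ([set x | 0 < dot x v] `&` (A `|` refl v @^-1` A)))//.
by apply: measurableU; apply: measurableI => //; exact: measurableU.
Qed.

Lemma measurable_kept v A : measurable A -> measurable (kept v A).
Proof.
move=> mA; have mr := measurable_refl_preimage v mA; have mp := measurable_pos v.
rewrite (_ : kept v A = (A `\` (refl v @^-1` A)) `&` [set x | 0 < dot x v]).
  by apply: measurableI => //; exact: measurableD.
by apply/seteqP; split => x; [case|case=> -[]].
Qed.

Lemma measurable_swapped v A : measurable A -> measurable (swapped v A).
Proof.
move=> mA; have mr := measurable_refl_preimage v mA; have mp := measurable_pos v.
rewrite (_ : swapped v A = ((refl v @^-1` A) `\` A) `&` [set x | 0 < dot x v]).
  by apply: measurableI => //; exact: measurableD.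
by apply/seteqP; split => x; [case|case=> -[]].
Qed.

Lemma polar_sphere v A : S v -> A `<=` S -> polar v A `<=` S.
Proof.
by move=> vS AS x [[/AS]|[_ [/AS|/AS]]]// /refl_sphere; exact.
Qed.

Lemma mem_polar v A x : (x \in polar v A) =
  if 0 < dot x v then (x \in A) || (refl v x \in A) else (x \in A) && (refl v x \in A).
Proof.
apply/idP/idP; rewrite ?inE => h.
  case: ifP => xv; case: h => [[/mem_set -> /mem_set ->]//|[xv']].
    by case=> /mem_set ->; rewrite ?orbT.
  by rewrite xv in xv'.
move: h; case: ifP => [xv /orP[] /set_mem|_ /andP[/set_mem ? /set_mem ?]]; last by left.
- by right; split => //; left.
- by right; split => //; right.
Qed.

Local Open Scope ereal_scope.

Lemma smeasureD_fin (A B : set E) : measurable A -> measurable B ->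
  smeasure A = smeasure (A `\` B) + smeasure (A `&` B).
Proof. by move=> mA mB; rewrite -measureDI. Qed.

Lemma polarD v A : polar v A `\` A = swapped v A.
Proof.
apply/seteqP; split => x [].
  by move=> [[]//|[xv [//|Arx]]] nAx; split.
by move=> nAx Arx xv; split => //; right; split => //; right.
Qed.

Lemma setD_polar v A : S v -> A `\` polar v A = refl v @^-1` swapped v A.
Proof.
move=> vS; apply/seteqP; split => x; rewrite /swapped/= reflK// dot_refl_axis// oppr_gt0.
  move=> [Ax nP]; have nArx : ~ A (refl v x) by move=> Arx; apply: nP; left.
  split => //; rewrite ltNge le_eqVlt; apply/negP => /orP[/eqP/esym xv|xv].
    by apply: nArx; rewrite refl_id.
  by apply: nP; right; split => //; left.
move=> [nArx Ax xv]; split => // -[[]//|[xv' _]].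
by have := lt_trans xv xv'; rewrite ltxx.
Qed.

(** The points lost are the mirror images of the points won, by [polarD] and [setD_polar]. *)
Lemma smeasure_polar v A : S v -> measurable A -> smeasure (polar v A) = smeasure A.
Proof.
move=> vS mA; have mp := measurable_polar v mA.
rewrite (smeasureD_fin mA mp) (smeasureD_fin mp mA) setIC; congr (_ + _).
by rewrite polarD setD_polar// smeasure_refl.
Qed.

Definition nonlocal (f : R -> R) A (z : E * E) : R :=
  (\1_A z.1 * \1_(S `\` A) z.2 * f (dot z.1 z.2))%R.

Definition perim (f : R -> R) A : \bar R := pair_int (nonlocal f A).

(* [f 1] is unconstrained: the diagonal never contributes to a perimeter, and a
   singular kernel has a junk value there. *)
Definition nonlocal_kernel (f : R -> R) := [/\ measurable_fun [set: R] f, forall u, (0 <= f u)%R &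
  {in `[(-1)%R, 1%R[ &, {homo f : u w / (u <= w)%R}}].

Lemma measurable_kernel (f : R -> R) (g h : E * E -> E) : nonlocal_kernel f ->
  measurable_fun [set: E * E] g -> measurable_fun [set: E * E] h ->
  measurable_fun [set: E * E] (fun z => f (dot (g z) (h z))).
Proof.
by move=> [mf _ _] mg mh; apply: (measurableT_comp mf); exact: measurable_dot.
Qed.

Lemma measurable_nonlocal f A : nonlocal_kernel f -> measurable A ->
  measurable_fun [set: E * E] (nonlocal f A).
Proof.
move=> kf mA; have mSA : measurable (S `\` A).
  by apply: measurableD => //; exact: measurable_sphere.
apply: measurable_funM; last exact: measurable_kernel.
by apply: measurable_funM; apply: measurableT_comp => //; exact: measurable_indic.
Qed.

Lemma nonlocal_ge0 f A z : nonlocal_kernel f -> (0 <= nonlocal f A z)%R.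
Proof.
by move=> [_ f0 _]; apply: mulr_ge0; [apply: mulr_ge0; exact: indic_ge0|exact: f0].
Qed.

(** Sum over the four pairs obtained by reflecting each variable or not: integrals are only
    multiplied by 4, and the comparison becomes pointwise. *)
Definition sym4 v (g : E * E -> R) (z : E * E) : R :=
  (g z + g (refl v z.1, z.2) + g (z.1, refl v z.2) + g (refl v z.1, refl v z.2))%R.

Lemma pair_int_sym4 v (g : E * E -> R) : S v -> measurable_fun [set: E * E] g ->
  (forall z, 0 <= g z)%R -> pair_int (sym4 v g) = 4%:E * pair_int g.
Proof.
move=> vS mg g0; have mr := measurable_refl v.
have mi := @measurable_id _ E setT.
have inv (phi psi : E -> E) : (phi = refl v \/ phi = id) -> (psi = refl v \/ psi = id) ->
    measurable_fun [set: E * E] (fun z : E * E => g (phi z.1, psi z.2)) /\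
    pair_int (fun z => g (phi z.1, psi z.2)) = pair_int g.
  move=> hphi hpsi; split.
    have mphi : measurable_fun [set: E] phi by case: hphi => ->.
    have mpsi : measurable_fun [set: E] psi by case: hpsi => ->.
    apply: (measurableT_comp (f := g) (g := fun z : E * E => (phi z.1, psi z.2))) => //.
    by apply: measurable_fun_pair; [apply: (measurableT_comp (f := phi))|
      apply: (measurableT_comp (f := psi))].
  apply: pair_int_comp => //.
  - by case: hphi => ->.
  - by case: hpsi => ->.
  - by case: hphi => -> // B _; exact: smeasure_refl.
  - by case: hpsi => -> // B _; exact: smeasure_refl.
  - by case: hphi => -> // x; exact: refl_sphere.
  - by case: hpsi => -> // x; exact: refl_sphere.
have [m1 e1] := inv (refl v) id (or_introl erefl) (or_intror erefl).
have [m2 e2] := inv id (refl v) (or_intror erefl) (or_introl erefl).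
have [m3 e3] := inv (refl v) (refl v) (or_introl erefl) (or_introl erefl).
rewrite /sym4 pair_intD//; last 2 first.
- by apply: measurable_funD => //; exact: measurable_funD.
- by move=> z; rewrite !addr_ge0.
rewrite pair_intD//; last 2 first.
- exact: measurable_funD.
- by move=> z; rewrite !addr_ge0.
rewrite pair_intD// e1 e2 e3.
case: (pair_int g) (pair_int_ge0 g0) => [r _|_|//].
  by rewrite -!EFinD -EFinM; congr EFin; ring.
by rewrite gt0_muley// lte_fin.
Qed.


(** A part of the drop of the four-pair sum under polarization, positive on kept times swapped
    points when [f] is strictly increasing; the equality case rests on it. *)
Definition excess f v A (z : E * E) : R :=
  (\1_(kept v A) z.1 * \1_(swapped v A) z.2 *
   (f (dot z.1 z.2) - f (dot z.1 (refl v z.2))))%R.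

(** Both points lie on the positive side, so reflecting [y] strictly lowers the inner product;
    membership in [A] separates [x] from [y]. Both values thus fall in the half-open interval where
    kernels are monotone. *)
Lemma kept_swapped_dot v A x y : S v -> A `<=` S -> kept v A x -> swapped v A y ->
  [/\ S x, S y & -1 <= dot x (refl v y) < dot x y /\ dot x y < 1]%R.
Proof.
move=> vS AS [Ax nArx xv] [nAy Ary yv].
have xS := AS _ Ax; have ryS := AS _ Ary.
have yS : S y by rewrite -(refl_sphere _ vS).
split => //; split; last first.
  by apply: dot_sphere_lt1 => //; apply: contra_notN nAy => /eqP <-.
have /andP[-> _]/= := dot_sphere_itv xS ryS.
by rewrite dot_reflr -mulrA ltrBlDr ltrDl !mulr_gt0.
Qed.

Lemma measurable_excess f v A : nonlocal_kernel f -> measurable A ->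
  measurable_fun [set: E * E] (excess f v A).
Proof.
move=> kf mA; apply: measurable_funM.
  apply: measurable_funM; apply: measurableT_comp => //; apply: measurable_indic.
    exact: measurable_kept.
  exact: measurable_swapped.
apply: measurable_funB; apply: measurable_kernel => //.
by apply: (measurableT_comp (measurable_refl v)).
Qed.

Lemma excess_ge0 f v A z : nonlocal_kernel f -> S v -> A `<=` S -> (0 <= excess f v A z)%R.
Proof.
move=> [_ _ fm] vS AS; rewrite /excess !indicE.
have [/set_mem hx|_] := boolP (z.1 \in kept v A); last by rewrite !mul0r.
have [/set_mem hy|_] := boolP (z.2 \in swapped v A); last by rewrite mulr0 mul0r.
rewrite !mul1r subr_ge0.
have [xS yS [/andP[h1 h2] h3]] := kept_swapped_dot vS AS hx hy.
by apply: fm; rewrite ?in_itv/= ?h1 ?(lt_trans h2)// ?(le_trans h1 (ltW h2))// ltW.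
Qed.

Lemma nonlocal_polar f v A x y : nonlocal_kernel f -> S v -> A `<=` S -> S x -> S y ->
  (sym4 v (nonlocal f (polar v A)) (x, y) + excess f v A (x, y) <=
   sym4 v (nonlocal f A) (x, y))%R.
Proof.
move=> [_ _ fm] vS AS xS yS.
have rxS : S (refl v x) by exact/refl_sphere.
have ryS : S (refl v y) by exact/refl_sphere.
have inD B z : S z -> (z \in S `\` B) = (z \notin B).
  by move=> zS; rewrite in_setD mem_set.
rewrite /sym4 /nonlocal /excess/= !indicE !inD// !mem_polar !reflK// !dot_refl_axis//.
rewrite !oppr_gt0 dot_refl// dot_refll//.
have keptE : (x \in kept v A) = [&& x \in A, refl v x \notin A & (0 < dot x v)%R].
  apply/idP/and3P => [/set_mem[Ax nA xv]|[/set_mem Ax nA xv]].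
    by split => //; [exact: mem_set|apply/negP => /set_mem].
  by apply/mem_set; split => // Arx; move: nA; rewrite mem_set.
have swappedE : (y \in swapped v A) = [&& y \notin A, refl v y \in A & (0 < dot y v)%R].
  apply/idP/and3P => [/set_mem[nA Ay yv]|[nA /set_mem Ay yv]].
    by split => //; [apply/negP => /set_mem|exact: mem_set].
  by apply/mem_set; split => // Ay'; move: nA; rewrite mem_set.
rewrite keptE swappedE.
have itv z w : S z -> S w -> z != w -> (dot z w \in `[(-1)%R, 1%R[).
  move=> zS wS zw; rewrite in_itv/= (dot_sphere_lt1 zS wS zw).
  by have /andP[->] := dot_sphere_itv zS wS.
have id0 z : (~~ ((0 < dot z v) || (dot z v < 0)))%R -> refl v z = z.
  by rewrite negb_or -!leNgt -eq_le => /eqP; exact: refl_id.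
apply: four_point.
- by apply/negP => /andP[/lt_trans h /h]; rewrite ltxx.
- by apply/negP => /andP[/lt_trans h /h]; rewrite ltxx.
- by case: (boolP ((0 < dot x v) || (dot x v < 0)))%R => //= /id0 ->.
- by case: (boolP ((0 < dot y v) || (dot y v < 0)))%R => //= /id0 ->.
(* If [x] and [y] coincide, the kernel sits at its unconstrained value at 1, but then the membership
   bits agree. The next case treats [x = refl v y] in the same way. *)
- move=> h; have [->|xy] := eqVneq x y; first by right.
  left; have lt1 : (dot x (refl v y) < dot x y)%R.
    rewrite dot_reflr -mulrA ltrBlDr ltrDl mulr_gt0//.
    by case/orP: h => /andP[h1 h2]; [rewrite mulr_gt0|rewrite nmulr_rgt0].
  apply: fm (ltW lt1); last exact: itv.
  apply: itv => //; apply: contraTneq lt1 => <-.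
  rewrite (sphereE x).1// -leNgt.
  by have /andP[] := dot_sphere_itv xS yS.
- move=> h; have [->|xy] := eqVneq x (refl v y); first by right; rewrite reflK.
  left; have lt1 : (dot x y < dot x (refl v y))%R.
    rewrite dot_reflr -mulrA ltrBrDr gtrDl pmulr_rlt0//.
    by case/orP: h => /andP[h1 h2]; [rewrite pmulr_rlt0|rewrite nmulr_rlt0].
  apply: fm (ltW lt1); last exact: itv.
  apply: itv => //; apply: contraTneq lt1 => <-.
  rewrite (sphereE x).1// -leNgt.
  by have /andP[] := dot_sphere_itv xS rxS.
- by case/orP => /id0 h; [rewrite -dot_refll// h|rewrite h].
Qed.

Lemma perim_polar f v A : nonlocal_kernel f -> S v -> measurable A -> A `<=` S ->
  4%:E * perim f (polar v A) + pair_int (excess f v A) <= 4%:E * perim f A.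
Proof.
move=> kf vS mA AS; have mP := measurable_polar v mA.
have mn := measurable_nonlocal kf mA; have mnP := measurable_nonlocal kf mP.
have n0 z := nonlocal_ge0 A z kf; have nP0 z := nonlocal_ge0 (polar v A) z kf.
have mex := @measurable_excess f v A kf mA.
have ex0 z := excess_ge0 z kf vS AS.
have ms4 g : measurable_fun [set: E * E] g -> measurable_fun [set: E * E] (sym4 v g).
  move=> mg; have mr := measurable_refl v.
  have comp (phi psi : E -> E) : measurable_fun [set: E] phi ->
      measurable_fun [set: E] psi ->
      measurable_fun [set: E * E] (fun z : E * E => g (phi z.1, psi z.2)).
    move=> mphi mpsi.
    apply: (measurableT_comp (f := g) (g := fun z : E * E => (phi z.1, psi z.2))) => //.
    by apply: measurable_fun_pair; [apply: (measurableT_comp (f := phi))|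
      apply: (measurableT_comp (f := psi))].
  apply: measurable_funD; last exact: comp.
  apply: measurable_funD; last exact: (comp id).
  by apply: measurable_funD => //; exact: (comp _ id).
rewrite /perim -!(pair_int_sym4 vS)// -pair_intD//.
- apply: pair_int_le => //.
  + by apply: measurable_funD => //; exact: ms4.
  + exact: ms4.
  + by move=> z; rewrite /sym4 !addr_ge0.
  + by move=> x y xS yS; exact: nonlocal_polar.
- exact: ms4.
- by move=> z; rewrite /sym4 !addr_ge0.
Qed.

Lemma perim_polar_le f v A : nonlocal_kernel f -> S v -> measurable A -> A `<=` S ->
  perim f (polar v A) <= perim f A.
Proof.
move=> kf vS mA AS; rewrite -(@lee_pmul2l _ 4)// ?lte_fin//.
apply: le_trans (perim_polar kf vS mA AS); rewrite leeDl// pair_int_ge0//.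
by move=> z; exact: excess_ge0.
Qed.

(** Finite perimeter allows cancellation in [perim_polar], so the excess has integral zero. As it is
    positive at every pair in kept times swapped, this product is null, and so is one of its
    factors. *)
Lemma perim_polar_eq f v A : nonlocal_kernel f ->
  {in `[(-1)%R, 1%R[ &, {homo f : u w / (u < w)%R}} ->
  S v -> measurable A -> A `<=` S ->
  perim f A < +oo -> perim f A <= perim f (polar v A) ->
  smeasure (kept v A) = 0 \/ smeasure (swapped v A) = 0.
Proof.
move=> kf fs vS mA AS foo le1; have kf' := kf; case: kf' => _ f0 _.
have mex := @measurable_excess f v A kf mA.
have ex0 z := excess_ge0 z kf vS AS.
have n0 z := nonlocal_ge0 A z kf.
have ex00 : pair_int (excess f v A) = 0.
  have Pfin : 4%:E * perim f A \is a fin_num.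
    by rewrite fin_numM// ge0_fin_numE// pair_int_ge0.
  apply/eqP; rewrite eq_le pair_int_ge0// andbT.
  rewrite -(@leeD2lE _ (4%:E * perim f A))// adde0; apply: le_trans (perim_polar kf vS mA AS).
  by rewrite leeD2r// lee_pmul2l// lte_fin.
have mK := measurable_kept v mA; have mW := measurable_swapped v mA.
suff : smeasure (kept v A) * smeasure (swapped v A) = 0.
  by move/eqP; rewrite mule_eq0 => /orP[] /eqP; [left|right].
rewrite -(@product_measure1E _ _ _ _ _ mu mu)//.
have : ae_eq (mu \x mu) (S `*` S) (fun z => (excess f v A z)%:E) (cst 0).
  apply/(@ae_eq_integral_abs _ _ _ (mu \x mu)).
  - exact: measurable_SS.
  - exact/measurable_funTS/measurable_EFinP.
  - rewrite -[RHS]ex00; apply: eq_integral => z _.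
    by rewrite gee0_abs// lee_fin.
move=> [N [mN N0 subN]]; apply: (subset_measure0 _ mN _ N0).
  exact: measurableX.
move=> [x y] [/= Kx Wy]; apply: subN => /= H.
have [xS yS [/andP[h1 h2] h3]] := kept_swapped_dot vS AS Kx Wy.
have := H (conj xS yS) => -[]; apply/eqP; rewrite /excess/= !indicE !mem_set//.
rewrite !mul1r subr_eq0 gt_eqF// fs//.
  by rewrite in_itv/= h1 (lt_trans h2).
by rewrite in_itv/= h3 (le_trans h1) ?(ltW h2).
Qed.

End polarization.

(** * Gain of measure by polarizing towards a cap *)

Section symmetrization.
Context (R : realType) (n : nat).
Local Notation E := (borel R n).
Local Notation S := (sphere R n).
Local Notation mu := (@smeasure R n).
Implicit Types (A C : set E) (v e : E).
Local Open Scope ereal_scope.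

(* For a cap [C] of centre [e]: membership only depends on, and is monotone in,
   the height [dot x e]. *)
Definition centered e C := [/\ measurable C, C `<=` S &
  forall x y, C x -> S y -> (dot x e <= dot y e)%R -> C y].

Definition gained v A C : set E :=
  [set y | [/\ C y, ~ A y, A (refl v y) & ~ C (refl v y)]].

Lemma measurable_gained v A C : measurable A -> measurable C ->
  measurable (gained v A C).
Proof.
move=> mA mC; rewrite (_ : gained v A C =
    (C `\` A) `&` (refl v @^-1` A `\` refl v @^-1` C)).
  by apply: measurableI; apply: measurableD => //; exact: measurable_refl_preimage.
by apply/seteqP; split => x; [case|case=> -[? ?] []].
Qed.

Lemma gainedN v A C : gained (- v)%R A C = gained v A C.
Proof. by apply/seteqP; split => x; rewrite /gained/= reflNl. Qed.

Lemma dot_refl_le v e x : S v -> (0 <= dot e v)%R ->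
  ((0 <= dot x v)%R -> (dot (refl v x) e <= dot x e)%R) /\
  ((dot x v <= 0)%R -> (dot x e <= dot (refl v x) e)%R).
Proof.
move=> vS ev; rewrite (dotC (refl v x)) dot_reflr (dotC e x) -mulrA.
split => xv; first by rewrite gerBl !mulr_ge0.
by rewrite lerBrDr gerDl pmulr_rle0// mulr_ge0_le0.
Qed.

Lemma gained_swapped v e A C : S v -> A `<=` S -> centered e C -> (0 <= dot e v)%R ->
  gained v A C `<=` swapped v A.
Proof.
move=> vS AS [_ CS Cup] ev y [Cy nAy Ary nCry]; split => //.
rewrite ltNge; apply/negP => yv; apply: nCry.
by apply: Cup Cy (AS _ Ary) _; exact: (dot_refl_le _ vS ev).2.
Qed.

(** Both sides share [C] minus [A] minus [polar v A]. The rest on the left is [gained] and the part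
    of [C] given up by polarization; the latter reflects into points of [C] that are won, since the
    positive side is the one nearer to [e]. *)
Lemma smeasure_gain v e A C : S v -> measurable A -> A `<=` S -> centered e C ->
  (0 <= dot e v)%R ->
  mu (C `\` polar v A) + mu (gained v A C) <= mu (C `\` A).
Proof.
move=> vS mA AS cC ev; have [mC CS Cup] := cC.
have mP := measurable_polar v mA; have mG := measurable_gained v mA mC.
have mCP := measurableD mC mP; have mCA := measurableD mC mA.
rewrite (smeasureD_fin mCP mA) (smeasureD_fin mCA mP).
have -> : C `\` polar v A `\` A = C `\` A `\` polar v A.
  by apply/seteqP; split => x [[? ?] ?].
rewrite -addeA leeD2l//.
pose D := refl v @^-1` ((C `\` polar v A) `&` A) : set E.
have mD : measurable D by apply: measurable_refl_preimage; exact: measurableI.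
have -> : mu ((C `\` polar v A) `&` A) = mu D by rewrite smeasure_refl.
have DW : D `<=` swapped v A.
  move=> y [[Cry nPry] Ary].
  have : (A `\` polar v A) (refl v y) by [].
  by rewrite setD_polar//= reflK.
have WP : swapped v A `<=` polar v A by rewrite -polarD => x [].
(* The mirror images of points of [D] lie in [C], those of gained points do not. *)
rewrite -measureU//; last first.
  by apply/seteqP; split => // y [[[Cry _] _] [_ _ _ nCry]]; exact: nCry.
apply: le_measure; rewrite ?inE.
- exact: measurableU.
- exact: measurableI.
- move=> y [Dy|Gy].
    have [nAy Ary yv] := DW _ Dy; have [[Cry _] _] := Dy.
    split; last by apply: WP; exact: DW.
    have yS : S y by apply/(refl_sphere _ vS); exact: CS.
    by split => //; apply: Cup Cry yS ((dot_refl_le _ vS ev).1 _); exact: ltW.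
  have Wy := gained_swapped vS AS cC ev Gy.
  by have [Cy nAy _ _] := Gy; split; [|exact: WP].
Qed.

(* [v |-> refl v y] is 4-Lipschitz and covers [S `\ y]; so the Hausdorff measure
   bounds from below the law of the reflection of [y] across a random mirror. *)
Lemma smeasure_refl_axis (y : E) (B : set E) : S y -> measurable B -> B `<=` S -> ~ B y ->
  mu B <= (4 ^+ n)%:E * mu [set v | B (refl v y)].
Proof.
move=> yS mB BS nBy; rewrite smeasureE// [X in _ <= _ * X]/smeasure/mrestr.
apply: le_trans (hausdorff_outer_lipschitz n (phi := fun v => refl v y) _ _) => //.
  apply: le_hausdorff_outer => z Bz; have zS := BS _ Bz.
  have [|v vS vz] := exists_refl yS zS; first by apply: contra_notN nBy => /eqP ->.
  by exists v => //; split => //=; rewrite vz.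
by move=> v w [_ vS] [_ wS]; exact: enorm_refl_axis.
Qed.

Lemma integral_smeasureT (f : E -> \bar R) : measurable_fun [set: E] f ->
  (forall x, 0 <= f x) -> \int[mu]_x f x = \int[mu]_(x in S) f x.
Proof.
move=> mf f0; have mSC : measurable (~` S) by apply: measurableC; exact: measurable_sphere.
rewrite (@ge0_negligible_integral _ _ _ mu setT (~` S))//.
  by rewrite setTD setCK.
transitivity (hausdorff n (~` S `&` S)); first by [].
by rewrite setICl measure0.
Qed.

(** Double counting of the pairs (v, y) with [y] in [C] minus [A] and [refl v y] in [A] minus [C].
    For a fixed axis [v] they form part of [gained v A C], of measure at most [q]; for fixed [y]
    their measure is bounded below by [smeasure_refl_axis]. *)
Lemma gained_average A C (q : \bar R) : measurable A -> measurable C -> A `<=` S -> C `<=` S ->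
  (forall v, S v -> mu (gained v A C) <= q) ->
  mu (C `\` A) * mu (A `\` C) <= (4 ^+ n)%:E * (q * mu S).
Proof.
move=> mA mC AS CS leq; have mS := @measurable_sphere R n.
have mCA := measurableD mC mA; have mAC := measurableD mA mC.
pose W := [set vy : E * E | (C `\` A) vy.2 /\ (A `\` C) (refl vy.1 vy.2)].
have mW : measurable W.
  have -> : W = snd @^-1` (C `\` A) `&`
    (fun vy : E * E => refl vy.1 vy.2 : E) @^-1` (A `\` C) by [].
  apply: measurableI; rewrite -[X in measurable X]setTI; first exact: measurable_snd.
  exact: measurable_refl2.
have mW1 v : measurable (xsection W v) by exact: measurable_xsection.
have mW2 y : measurable (ysection W y) by exact: measurable_ysection.
apply: (@le_trans _ _ ((4 ^+ n)%:E * \int[mu]_v mu (xsection W v))); last first.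
  apply: lee_wpmul2l; first by rewrite lee_fin exprn_ge0.
  rewrite -(integral_cst mu mS).
  have mX : measurable_fun [set: E] (fun v => mu (xsection W v)).
    exact: measurable_fun_xsection.
  rewrite (integral_smeasureT mX); last by move=> v; exact: measure_ge0.
  apply: ge0_le_integral.
  - exact: mS.
  - by move=> v _; exact: measure_ge0.
  - exact: measurable_funTS.
  - exact: measurable_cst.
  - move=> v vS; apply: le_trans (leq v vS).
    apply: le_measure; rewrite ?inE//; first exact: measurable_gained.
    by move=> y; rewrite /xsection/= inE => -[[Cy nAy] [Ary nCry]].
have FG : \int[mu]_v mu (xsection W v) = \int[mu]_y mu (ysection W y).
  have := @indic_fubini_tonelli _ _ _ _ _ mu mu W mW.
  by rewrite (indic_fubini_tonelli_FE mu mW) (indic_fubini_tonelli_GE mu mW).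
have mY : measurable_fun [set: E] (fun y => mu (ysection W y)).
  exact: measurable_fun_ysection.
rewrite {}FG -ge0_integralZl; last 4 first.
- exact: measurableT.
- exact: mY.
- by move=> y _; exact: measure_ge0.
- by rewrite lee_fin exprn_ge0.
apply: (@le_trans _ _ (\int[mu]_(y in C `\` A) cst (mu (A `\` C)) y)).
  by rewrite integral_cst// muleC.
rewrite [leLHS]integral_mkcond; apply: ge0_le_integral.
- exact: measurableT.
- by move=> y _; apply: erestrict_ge0 => z _; exact: measure_ge0.
- exact: (measurable_restrictT _ mCA).1 (measurable_cst _).
- exact: measurable_funeM.
move=> y _; rewrite patchE; case: ifPn => [/set_mem[Cy nAy]|_]; last first.
  by apply: mule_ge0; [rewrite lee_fin exprn_ge0|exact: measure_ge0].
apply: (le_trans (smeasure_refl_axis (CS _ Cy) mAC _ _)) => //.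
- by move=> z [/AS].
- by move=> -[].
apply: lee_wpmul2l; first by rewrite lee_fin exprn_ge0.
have -> : [set v | (A `\` C) (refl v y)] = ysection W y; last by [].
by apply/seteqP; split => v; rewrite /ysection/= inE => -[].
Qed.

End symmetrization.

(** * Minimality of caps *)

Section cap_comparison.
Context (R : realType) (n : nat).
Local Notation E := (borel R n).
Local Notation S := (sphere R n).
Local Notation mu := (@smeasure R n).
Implicit Types (A B C : set E) (v e : E) (f : R -> R).
Local Open Scope ereal_scope.

Lemma smeasure_fin_num A : measurable A -> mu A \is a fin_num.
Proof. exact: fin_num_measure. Qed.

Lemma smeasure_setD_eq A C : measurable A -> measurable C -> mu A = mu C ->
  mu (A `\` C) = mu (C `\` A).
Proof.
move=> mA mC; rewrite (smeasureD_fin mA mC) (smeasureD_fin mC mA) (setIC C A).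
have fin := smeasure_fin_num (measurableI _ _ mA mC).
by move=> h; apply/eqP; rewrite eq_le -(leeD2rE _ _ fin) h lexx/= -(leeD2rE _ _ fin) h.
Qed.

Inductive polar_iter A : set E -> Prop :=
| polar_iter0 : polar_iter A A
| polar_iterS v B : S v -> polar_iter A B -> polar_iter A (polar v B).

Lemma polar_iterP A B : measurable A -> A `<=` S -> polar_iter A B ->
  [/\ measurable B, B `<=` S, mu B = mu A &
      forall f, nonlocal_kernel f -> perim f B <= perim f A].
Proof.
move=> mA AS; elim=> [|v {}B vS _ [mB BS muB PB]]; first by split.
split.
- exact: measurable_polar.
- exact: polar_sphere.
- by rewrite smeasure_polar.
- by move=> f kf; apply: le_trans (PB f kf); exact: perim_polar_le.
Qed.

(** Consider the infimum [d] of the measure of [C] minus [B] over the iterated polarizations [B] of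
    [A]. If it were positive, a nearly optimal [B] could gain only little from any further
    polarization, against [gained_average], whose left side is the square of this measure. *)
Lemma polar_approx e C A (eps : R) : centered e C -> measurable A -> A `<=` S ->
  mu A = mu C -> (0 < eps)%R ->
  exists2 B, polar_iter A B & mu (C `\` B) <= eps%:E.
Proof.
move=> cC mA AS muAC eps0; have [mC CS _] := cC.
apply: contrapT => H.
have far B : polar_iter A B -> (eps <= fine (mu (C `\` B)))%R.
  move=> AB; have [mB BS _ _] := polar_iterP mA AS AB.
  rewrite -lee_fin fineK ?smeasure_fin_num//; last exact: measurableD.
  by rewrite leNgt; apply/negP => /ltW le; apply: H; exists B.
pose D := [set fine (mu (C `\` B)) | B in polar_iter A].
have Dlb : lbound D eps by move=> _ [B AB <-]; exact: far.
have D0 : D !=set0 by exists (fine (mu (C `\` A))), A => //; exact: polar_iter0.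
have Dinf : has_inf D by split => //; exists eps.
pose d := inf D; have d0 : (0 < d)%R by exact: lt_le_trans eps0 (lb_le_inf D0 Dlb).
pose K := (4 ^+ n * fine (mu S))%R.
have K0 : (0 <= K)%R by rewrite mulr_ge0 ?exprn_ge0 ?fine_ge0.
(* This slack makes [K * eta] smaller than [d ^+ 2]; adding 1 keeps the denominator positive. *)
pose eta := (d ^+ 2 / (K + 1))%R.
have eta0 : (0 < eta)%R by rewrite divr_gt0 ?exprn_gt0// ltr_wpDl.
have [_ [B AB <-] dB] := inf_adherent eta0 Dinf.
have [mB BS muB _] := polar_iterP mA AS AB.
have muCB := smeasure_fin_num (measurableD mC mB).
have gain v : S v -> mu (gained v B C) <= eta%:E.
  (* The axes [v] and [- v] have the same mirror, so the axis may be taken on the side of the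
     centre. *)
  move=> vS; wlog ev : v vS / (0 <= dot e v)%R.
    move=> H'; have [/H'|/ltW ev] := leP 0%R (dot e v); first exact.
    rewrite -(opprK v) gainedN; apply: H'; first exact/sphereN.
    by rewrite dotNr oppr_ge0.
  have mG := smeasure_fin_num (measurable_gained v mB mC).
  have mP := smeasure_fin_num (measurableD mC (measurable_polar v mB)).
  have := smeasure_gain vS mB BS cC ev.
  rewrite -(fineK mG) -(fineK mP) -(fineK muCB) -EFinD !lee_fin.
  have : (d <= fine (mu (C `\` polar v B)))%R.
    by apply: (ge_inf (ex_intro _ _ Dlb)); exists (polar v B) => //; exact: polar_iterS.
  by move: dB; rewrite -/d; lra.
have := gained_average mB mC BS CS gain.
rewrite (smeasure_setD_eq mB mC); last by rewrite muB.
have muS := smeasure_fin_num (@measurable_sphere R n).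
rewrite -(fineK muCB) -(fineK muS) -!EFinM lee_fin mulrCA -/K.
have dB' : (d <= fine (mu (C `\` B)))%R by apply: (ge_inf (ex_intro _ _ Dlb)); exists B.
rewrite leNgt => /negP; apply; apply: (@lt_le_trans _ _ (d * d)%R).
  rewrite /eta mulrAC -expr2 ltr_pdivrMr ?ltr_wpDl//.
  by rewrite ltr_pM2l ?exprn_gt0// ltrDl.
by rewrite ler_pM// ltW.
Qed.

Lemma pair_int_setX A B (N : R) : measurable A -> measurable B -> A `<=` S -> B `<=` S ->
  (0 <= N)%R ->
  pair_int (fun z : E * E => N * \1_(A `*` B) z)%R = N%:E * (mu A * mu B).
Proof.
move=> mA mB AS BS N0; have mAB := measurableX mA mB.
rewrite pair_intZ//; congr (_ * _).
rewrite /pair_int integral_indic//; last exact: measurable_SS.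
rewrite setIidl; last by move=> [x y] [/= /AS ? /BS ?].
exact: (@product_measure1E _ _ _ _ _ mu mu).
Qed.

(** A pair counted for [A] but not for [B] has its first point in [A] minus [B] or its second in [B]
    minus [A]. *)
Lemma perim_continuity f A B (N : R) : nonlocal_kernel f -> (forall u, f u <= N)%R ->
  measurable A -> measurable B -> A `<=` S -> B `<=` S ->
  perim f A <= perim f B + N%:E * (mu (A `\` B) * mu S) + N%:E * (mu S * mu (B `\` A)).
Proof.
move=> kf fN mA mB AS BS; have [mf f0 _] := kf; have mS := @measurable_sphere R n.
have N0 : (0 <= N)%R by exact: le_trans (f0 0%R) (fN 0%R).
have mAB := measurableD mA mB; have mBA := measurableD mB mA.
have i0 (W : set (E * E)) z : (0 <= N * \1_W z)%R by rewrite mulr_ge0// indic_ge0.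
have mi (W : set (E * E)) : measurable W ->
    measurable_fun [set: E * E] (fun z => N * \1_W z)%R.
  by move=> mW; apply: measurable_funM => //; exact: measurable_indic.
have m1 := measurableX mAB mS; have m2 := measurableX mS mBA.
rewrite -!pair_int_setX//; last 2 first.
- by move=> x [/BS].
- by move=> x [/AS].
have mn := measurable_nonlocal kf mB.
rewrite /perim -pair_intD//; last 2 first.
- exact: mi.
- by move=> z; exact: nonlocal_ge0.
rewrite -pair_intD//; last 3 first.
- by apply: measurable_funD => //; exact: mi.
- exact: mi.
- by move=> z; rewrite addr_ge0//; exact: nonlocal_ge0.
apply: pair_int_le.
- exact: measurable_nonlocal.
- by apply: measurable_funD; [apply: measurable_funD => //|]; exact: mi.
- by move=> z; exact: nonlocal_ge0.
move=> x y xS yS; rewrite /nonlocal/= !indicE !in_setX !in_setD/= !(mem_set xS) !(mem_set yS).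
have := f0 (dot x y); have := fN (dot x y).
by case: (x \in A); case: (x \in B); case: (y \in A); case: (y \in B) => /=; lra.
Qed.

Lemma kernel_min f (N : R) : nonlocal_kernel f -> (0 <= N)%R ->
  nonlocal_kernel (fun u => Num.min (f u) N).
Proof.
move=> [mf f0 fm] N0; split.
- exact: measurable_minr.
- by move=> u; rewrite le_min f0.
- by move=> u w hu hw uw; rewrite le_min !ge_min lexx orbT andbT fm.
Qed.

(** Monotone convergence: [f] has finite values, so at each pair the truncations are eventually
    equal to it. *)
Lemma perim_trunc f A (M : \bar R) : nonlocal_kernel f -> measurable A ->
  (forall k : nat, perim (fun u => Num.min (f u) k%:R) A <= M) -> perim f A <= M.
Proof.
move=> kf mA leM; have kk k := kernel_min kf (ler0n R k).
pose g k (z : E * E) := (nonlocal (fun u => Num.min (f u) k%:R) A z)%:E.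
have gE z : (nonlocal f A z)%:E = limn (g^~ z).
  apply/esym/cvg_lim => //; apply: cvg_near_cst.
  near=> k; rewrite /g /nonlocal min_l//.
  by near: k; exact: nbhs_infty_ger.
rewrite /perim /pair_int (eq_integral (fun z => limn (g^~ z))); last by move=> z _.
rewrite monotone_convergence.
- apply: lime_le; last exact: nearW leM.
  apply: ereal_nondecreasing_is_cvgn => j k jk.
  apply: pair_int_le.
  + exact: measurable_nonlocal.
  + exact: measurable_nonlocal.
  + by move=> z; exact: nonlocal_ge0.
  + move=> x y _ _; apply: ler_wpM2l; first by rewrite mulr_ge0// indic_ge0.
    by rewrite le_min !ge_min lexx/= (ler_nat R j k) jk orbT.
- exact: measurable_SS.
- by move=> k; apply/measurable_funTS/measurable_EFinP; exact: measurable_nonlocal.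
- by move=> k z _; rewrite lee_fin nonlocal_ge0.
- move=> z _ j k jk; rewrite lee_fin; apply: ler_wpM2l; first by rewrite mulr_ge0// indic_ge0.
  by rewrite le_min !ge_min lexx/= (ler_nat R j k) jk orbT.
Unshelve. all: by end_near. Qed.

Lemma perim_centered_le_bounded f e C A (N : R) : nonlocal_kernel f ->
  (forall u, f u <= N)%R -> centered e C ->
  measurable A -> A `<=` S -> mu A = mu C -> perim f C <= perim f A.
Proof.
move=> kf fN cC mA AS muAC; have [mC CS _] := cC; have [_ f0 _] := kf.
have N0 : (0 <= N)%R by exact: le_trans (f0 0%R) (fN 0%R).
have muS := smeasure_fin_num (@measurable_sphere R n).
pose M := fine (mu S); have M0 : (0 <= M)%R by rewrite fine_ge0.
apply/lee_addgt0Pr => eps eps0.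
(* The two error terms of [perim_continuity] add up to at most [2 * N * M * d], which stays below
   [eps]. *)
pose d := (eps / (2 * N * M + 1))%R.
have den0 : (0 < 2 * N * M + 1)%R by rewrite ltr_wpDl// !mulr_ge0.
have d0 : (0 < d)%R by rewrite divr_gt0.
have [B AB CB] := polar_approx cC mA AS muAC d0.
have [mB BS muB PB] := polar_iterP mA AS AB.
apply: le_trans (perim_continuity kf fN mC mB CS BS) _.
rewrite (smeasure_setD_eq mB mC) ?muB// -addeA.
apply: leeD; first exact: PB.
rewrite -(fineK muS) -/M.
have fCB := smeasure_fin_num (measurableD mC mB).
move: CB; rewrite -(fineK fCB) -!EFinM -EFinD !lee_fin => CB.
move: (fine _) CB => x xd.
have -> : (N * (x * M) + N * (M * x) = (2 * N * M) * x)%R by ring.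
have : ((2 * N * M) * x <= (2 * N * M) * d)%R by rewrite ler_wpM2l// !mulr_ge0.
move=> /le_trans; apply; rewrite /d mulrCA ler_piMr// ?ltW//.
by rewrite ltr_pdivrMr// mul1r ltrDl.
Qed.

Lemma perim_centered_le f e C A : nonlocal_kernel f -> centered e C ->
  measurable A -> A `<=` S -> mu A = mu C -> perim f C <= perim f A.
Proof.
move=> kf cC mA AS muAC; have [mC CS _] := cC.
apply: perim_trunc => // N; have kN := kernel_min kf (ler0n R N).
apply: (@le_trans _ _ (perim (fun u => Num.min (f u) N%:R) A)); last first.
  apply: pair_int_le.
  - exact: measurable_nonlocal.
  - exact: measurable_nonlocal.
  - by move=> z; exact: nonlocal_ge0.
  - move=> x y _ _; apply: ler_wpM2l; first by rewrite mulr_ge0// indic_ge0.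
    by rewrite ge_min lexx.
apply: (perim_centered_le_bounded (N := N%:R) kN _ cC) => // u.
by rewrite ge_min lexx orbT.
Qed.

End cap_comparison.

(** * The case of equality *)

Section equality_case.
Context (R : realType) (n : nat).
Local Notation E := (borel R n).
Local Notation S := (sphere R n).
Local Notation mu := (@smeasure R n).
Implicit Types (A B C : set E) (v e : E) (f : R -> R).
Local Open Scope ereal_scope.

Definition moment A v : \bar R := \int[mu]_(x in A) (dot x v)%:E.

Lemma integrable_bounded_on A (g : E -> R) : measurable A ->
  measurable_fun [set: E] g -> (exists M, forall x, A x -> `|g x| <= M)%R ->
  mu.-integrable A (EFin \o g).
Proof.
move=> mA mg [M gM]; apply: measurable_bounded_integrable => //.
- by rewrite ltey_eq smeasure_fin_num.
- exact: measurable_funTS.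
- exists M; split; first exact: num_real.
  by move=> M' MM' x Ax; exact: le_trans (gM x Ax) (ltW MM').
Qed.

Lemma momentE A v : measurable A -> A `<=` S ->
  moment A v = (dot (\row_i fine (\int[mu]_(x in A) ((x : 'rV[R]_n.+1) 0 i)%:E)) v)%:E.
Proof.
move=> mA AS; rewrite /moment /dot.
have int i : mu.-integrable A (EFin \o (fun x : E => (x : 'rV[R]_n.+1) 0%R i : R)).
  apply: integrable_bounded_on => //; first exact: measurable_coord.
  by exists 1%R => x /AS; exact: sphere_coord_le1.
under eq_integral do rewrite -sumEFin.
rewrite (@integral_sum _ _ _ mu _ _ _
  (fun (i : 'I_n.+1) (x : E) => ((x : 'rV[R]_n.+1) 0 i * (v : 'rV[R]_n.+1) 0 i)%:E))//.
  rewrite -sumEFin; apply: eq_bigr => i _; rewrite mxE EFinM fineK; last first.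
    by apply: integrable_fin_num => //; exact: int.
  rewrite muleC -(integralZl mA (int i)); apply: eq_integral => x _.
  by rewrite EFinM muleC.
move=> i; have := @integrableZl _ _ _ mu A mA ((v : 'rV[R]_n.+1) 0%R i) _ (int i).
by apply: eq_integrable => // x _; rewrite /= EFinM muleC.
Qed.

(** The moment is the inner product with the vector [m] of coordinate integrals, so the direction of
    [m] serves. If [m] vanishes, so do all moments, and any unit vector does. *)
Lemma barycenter_direction A : measurable A -> A `<=` S ->
  exists2 e, S e & forall v, (0 <= dot e v)%R -> 0 <= moment A v.
Proof.
move=> mA AS; set m := \row_i fine (\int[mu]_(x in A) ((x : 'rV[R]_n.+1) 0 i)%:E).
have [m0|m0] := eqVneq m 0%R.
  exists (delta_mx 0%R 0%R).
    apply/sphereE; rewrite /dot (bigD1 0%R)//= big1 => [|i i0]; rewrite !mxE.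
      by rewrite eqxx mulr1 addr0.
    by rewrite (negbTE i0) mul0r.
  by move=> v _; rewrite momentE// -/m m0 -(scale0r 0%R) dotZl mul0r.
have em : (0 < enorm m)%R by rewrite lt_def enorm_eq0 m0 enorm_ge0.
exists ((enorm m)^-1 *: m)%R.
  by rewrite /sphere/= enormZ gtr0_norm ?invr_gt0// mulVf// gt_eqF.
by move=> v; rewrite dotZl pmulr_rge0 ?invr_gt0// momentE.
Qed.

Lemma null_of_integral_le0 B (g : E -> R) : measurable B ->
  measurable_fun [set: E] g -> (forall x, B x -> 0 < g x)%R ->
  \int[mu]_(x in B) (g x)%:E <= 0 -> mu B = 0.
Proof.
move=> mB mg g0 int0.
have : ae_eq mu B (fun x => (g x)%:E) (cst 0).
  apply/(@ae_eq_integral_abs _ _ _ mu) => //; first exact/measurable_funTS/measurable_EFinP.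
  apply/eqP; rewrite eq_le integral_ge0// andbT.
  rewrite (eq_integral (fun x => (g x)%:E))// => x /set_mem Bx.
  by rewrite gee0_abs// lee_fin ltW// g0.
move=> [N [mN N0 subN]]; apply: (subset_measure0 mB mN _ N0) => x Bx.
by apply: subN => /= /(_ Bx)[] g0'; have := g0 _ Bx; rewrite g0' ltxx.
Qed.

(** Let [B] be the mirror image of [A]. If the kept points are null, the positive part of [dot x v]
    has the same integral over [A] as over the intersection with [B], while the negative part over
    [A] integrates to the positive part over [B]. A nonnegative moment then leaves nothing for [B]
    minus [A], where the swapped points lie. *)
Lemma moment_kept0 A v : S v -> measurable A -> A `<=` S -> 0 <= moment A v ->
  mu (kept v A) = 0 -> mu (swapped v A) = 0.
Proof.
move=> vS mA AS L0 K0.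
pose p (x : E) : R := Num.max (dot x v) 0%R.
pose B : set E := refl v @^-1` A.
have mB : measurable B by exact: measurable_refl_preimage.
have BS : B `<=` S by move=> x /AS /(refl_sphere _ vS).
have p0 x : (0 <= p x)%R by rewrite le_max lexx orbT.
have mp : measurable_fun [set: E] p.
  by apply: measurable_maxr => //; exact: measurable_dot.
have mpE D : measurable_fun D (fun x => (p x)%:E).
  exact/measurable_funTS/measurable_EFinP.
have split2 X Y : measurable X -> measurable Y ->
    \int[mu]_(x in X) (p x)%:E =
    \int[mu]_(x in X `&` Y) (p x)%:E + \int[mu]_(x in X `\` Y) (p x)%:E.
  move=> mX mY; rewrite -ge0_integral_setU//; last 4 first.
  - exact: measurableI.
  - exact: measurableD.
  - by move=> *; rewrite lee_fin.
  - by rewrite disj_set2E; apply/eqP/seteqP; split => // x [[_ ?] []].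
  by rewrite setUIDK.
have eqA : \int[mu]_(x in A) (p x)%:E = \int[mu]_(x in A `&` B) (p x)%:E.
  rewrite (split2 A B)// [X in _ + X](_ : _ = 0) ?adde0//.
  have mK := measurable_kept v mA.
  rewrite (@ge0_negligible_integral _ _ _ mu _ (kept v A))//; last 2 first.
  - exact: measurableD.
  - by move=> *; rewrite lee_fin.
  apply: integral0_eq => x [[Ax nBx] nK]; congr EFin; apply: max_r.
  by rewrite leNgt; apply/negP => xv; apply: nK.
have eqB : \int[mu]_(x in A) (Num.max (- dot x v) 0)%:E = \int[mu]_(x in B) (p x)%:E.
  have mr := measurable_refl v.
  transitivity (\int[pushforward mu (refl v : E -> E)]_(x in A) (Num.max (- dot x v) 0)%:E).
    by apply: eq_measure_integral => D mD _; exact/esym/smeasure_refl.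
  rewrite ge0_integral_pushforward//.
  - by apply: eq_integral => x _; rewrite /= dot_refl_axis// opprK.
  - apply/measurable_funTS/measurable_EFinP; apply: measurable_maxr => //.
    by apply: measurableT_comp => //; exact: measurable_dot.
  - by move=> *; rewrite lee_fin le_max lexx orbT.
have fin : \int[mu]_(x in A `&` B) (p x)%:E \is a fin_num.
  apply: integrable_fin_num; first exact: measurableI.
  apply: (@integrable_bounded_on _ p) => //; first exact: measurableI.
  exists 1%R => x [/AS xS _]; rewrite ger0_norm// ge_max ler01 andbT.
  by have /andP[] := dot_sphere_itv xS vS.
have mW := measurable_swapped v mA.
apply: (@null_of_integral_le0 _ (fun x => dot x v)) => //.
- exact: measurable_dot.
- by move=> x [].
apply: (@le_trans _ _ (\int[mu]_(x in B `\` A) (p x)%:E)).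
  rewrite (eq_integral (fun x => (p x)%:E)); last first.
    by move=> x /set_mem[_ _ xv]; rewrite /p max_l// ltW.
  apply: ge0_subset_integral => //.
  - exact: measurableD.
  - by move=> *; rewrite lee_fin.
  - by move=> x [].
rewrite -(leeD2lE _ _ fin) adde0 [X in X + _](_ : _ = \int[mu]_(x in B `&` A) (p x)%:E).
  rewrite -split2// -eqA -eqB.
  move: L0; rewrite /moment integralE.
  rewrite (eq_integral (fun x => (p x)%:E)); last by move=> x _; rewrite /p EFin_max funeposE.
  rewrite [X in _ - X](eq_integral (fun x : E => (Num.max (- dot x v) 0)%:E)); last first.
    by move=> x _; rewrite EFin_max funenegE.
  by rewrite subre_ge0 eqA.
by rewrite setIC.
Qed.

(** The cap to compare with is centred at the barycenter direction of [A], found only inside the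
    proof; hence the family [F] indexed by all centres. For mirrors facing this centre,
    [perim_polar_eq] and [moment_kept0] make the swapped points null, so nothing is gained and
    [gained_average] applies with bound 0. *)
Lemma perim_centered_eq f e C A (F : E -> set E) :
  nonlocal_kernel f -> {in `[(-1)%R, 1%R[ &, {homo f : u w / (u < w)%R}} ->
  (forall e, S e -> centered e (F e) /\ mu (F e) = mu C) ->
  centered e C -> measurable A -> A `<=` S -> mu A = mu C ->
  perim f C < +oo -> perim f A = perim f C ->
  exists2 e, S e & mu (A `\` F e) = 0 /\ mu (F e `\` A) = 0.
Proof.
move=> kf fs caps cC mA AS muAC PCfin PAC.
have [e' e'S pos] := barycenter_direction mA AS.
have [cC' muC'] := caps e' e'S; exists e' => //; move: (F e') cC' muC' => C' cC' muC'.
have [mC' C'S _] := cC'.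
have gain v : S v -> mu (gained v A C') <= 0.
  move=> vS; wlog ev : v vS / (0 <= dot e' v)%R.
    move=> H'; have [/H'|/ltW ev] := leP 0%R (dot e' v); first exact.
    rewrite -(opprK v) gainedN; apply: H'; first exact/sphereN.
    by rewrite dotNr oppr_ge0.
  have mW := measurable_swapped v mA; have mG := measurable_gained v mA mC'.
  suff W0 : mu (swapped v A) = 0.
    rewrite -W0; apply: le_measure; rewrite ?inE//.
    exact: gained_swapped vS AS cC' ev.
  have PAfin : perim f A < +oo by rewrite PAC.
  have PAle : perim f A <= perim f (polar v A).
    rewrite PAC; apply: (perim_centered_le kf cC).
    - exact: measurable_polar.
    - exact: polar_sphere.
    - by rewrite smeasure_polar.
  have [K0|//] := perim_polar_eq kf fs vS mA AS PAfin PAle.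
  by apply: moment_kept0 K0 => //; exact: pos.
have := gained_average mA mC' AS C'S gain.
have muAC' : mu A = mu C' by rewrite muC'.
rewrite mul0e mule0 (smeasure_setD_eq mA mC' muAC') => sq0.
have CA0 : mu (C' `\` A) = 0.
  by apply/eqP; rewrite -[_ == _]orbb -mule_eq0 eq_le sq0 mule_ge0.
by split.
Qed.
End equality_case.

(** * Conformal maps of the sphere *)

Section mobius.
Context (R : realType) (n : nat).
Local Notation E := (borel R n).
Local Notation S := (sphere R n).
Implicit Types (x y e : E) (a b : R).

(* The conformal automorphism of the sphere with poles [e] and [-e] that acts on
   heights [t = dot x e] by [t |-> (a t + b) / (b t + a)], where [a^2 - b^2 = 1]. *)
Definition mobius a b e x : E :=
  (b * dot x e + a)^-1 *: ((x : 'rV[R]_n.+1) + ((a - 1) * dot x e + b) *: (e : 'rV[R]_n.+1)).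

Context (a b : R) (e : E) (a0 : 0 < a) (ab : a ^+ 2 - b ^+ 2 = 1) (eS : S e).

Lemma mobius_den_gt0 x : S x -> 0 < b * dot x e + a.
Proof.
move=> xS; have /andP[h1 h2] := dot_sphere_itv xS eS.
have : `|b| < a.
  have b2 : `|b| ^+ 2 < a ^+ 2 by rewrite real_normK ?num_real// -subr_gt0 ab.
  by move: b2; rewrite ltr_pXn2r// nnegrE ?normr_ge0// ltW.
have : `|b * dot x e| <= `|b| by rewrite normrM ler_piMr// ler_norml h1.
move=> h3 h4; have := le_lt_trans h3 h4; rewrite ltr_norml => /andP[]; lra.
Qed.

Lemma mobius_dot_axis x : S x ->
  dot (mobius a b e x) e = (a * dot x e + b) / (b * dot x e + a).
Proof.
move=> xS; rewrite /mobius dotZl dotDl dotZl (sphereE e).1// mulr1 mulrC.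
by congr (_ / _); ring.
Qed.

(** Conformality in global form: by [dot_distE], squared chords are divided by the product of the
    two denominators. Invariance of the sphere and the Lipschitz bounds follow from it. *)
Lemma mobius_dot x y : S x -> S y ->
  1 - dot (mobius a b e x) (mobius a b e y) =
  (1 - dot x y) / ((b * dot x e + a) * (b * dot y e + a)).
Proof.
move=> xS yS; have := mobius_den_gt0 xS; have := mobius_den_gt0 yS.
rewrite /mobius !dotE (sphereE e).1// (dotC e y).
move: (dot x e) (dot y e) (dot x y) => t u w Du Dt.
have b2 : b ^+ 2 = a ^+ 2 - 1 by rewrite -ab opprB addrC subrK.
have Du0 : b * u + a != 0 by rewrite gt_eqF.
have Dt0 : b * t + a != 0 by rewrite gt_eqF.
by field: b2; rewrite Dt0 Du0.
Qed.

Lemma mobius_sphere x : S x -> S (mobius a b e x).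
Proof.
move=> xS; apply/sphereE/eqP; rewrite eq_sym -subr_eq0 mobius_dot//.
by rewrite (sphereE x).1// subrr mul0r.
Qed.

Lemma mobius_lipschitz (c : R) x y : S x -> S y -> 0 < c ->
  c <= b * dot x e + a -> c <= b * dot y e + a ->
  enorm (mobius a b e x - mobius a b e y) <= c^-1 * enorm (x - y).
Proof.
move=> xS yS c0 cx cy.
rewrite -[c^-1]gtr0_norm ?invr_gt0// -enormZ ler_enorm_sqr dotZl dotZr.
rewrite !dot_distE//; [|exact: mobius_sphere|exact: mobius_sphere].
rewrite mobius_dot// mulrA (mulrA c^-1) [leRHS]mulrC; apply: ler_wpM2l.
  by rewrite mulr_ge0// subr_ge0; have /andP[] := dot_sphere_itv xS yS.
rewrite -invfM lef_pV2 ?posrE ?mulr_gt0//; try exact: mobius_den_gt0.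
by apply: ler_pM => //; exact: ltW.
Qed.

End mobius.

Section mobius_inverse.
Context (R : realType) (n : nat).
Local Notation E := (borel R n).
Local Notation S := (sphere R n).

Lemma mobiusK (a b : R) (e x : E) : 0 < a -> a ^+ 2 - b ^+ 2 = 1 -> S e -> S x ->
  mobius a (- b) e (mobius a b e x) = x.
Proof.
move=> a0 ab eS xS; have D0 := mobius_den_gt0 a0 ab eS xS.
have b2 : b ^+ 2 = a ^+ 2 - 1 by rewrite -ab opprB addrC subrK.
have D'E : - b * dot (mobius a b e x) e + a = (b * dot x e + a)^-1.
  by rewrite mobius_dot_axis//; field: b2; rewrite gt_eqF.
rewrite {1}/mobius D'E invrK mobius_dot_axis// /mobius scalerDr scalerA divff ?gt_eqF//.
rewrite scale1r -addrA scalerA -scalerDl -[RHS]addr0; congr (_ + _).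
rewrite [X in X *: _](_ : _ = 0) ?scale0r//.
by field: b2; rewrite gt_eqF.
Qed.

End mobius_inverse.

(** * Measure of small balls and of thin shells *)

Section measure_bounds.
Context (R : realType) (n : nat).
Local Notation E := (borel R n).
Local Notation S := (sphere R n).
Local Notation mu := (@smeasure R n).
Local Open Scope ereal_scope.

Lemma measurable_height (e : E) (J : set R) : measurable J ->
  measurable [set x : E | J (dot x e)].
Proof.
move=> mJ; rewrite -[X in measurable X]setTI.
by apply: measurable_dot => //; exact: measurable_cst.
Qed.

Lemma measurable_sphere_height (e : E) (J : set R) : measurable J ->
  measurable [set x : E | S x /\ J (dot x e)].
Proof.
by move=> mJ; apply: measurableI; [exact: measurable_sphere|exact: measurable_height].
Qed.

(* The Moebius map of dilation factor [rho] carries a hemisphere onto the cap. *)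
Lemma smeasure_cap_le (e : E) (rho : R) : S e -> (0 < rho < 1)%R ->
  mu [set x | S x /\ (1 - rho ^+ 2 / 2 <= dot x e)%R] <= (rho ^+ n)%:E * mu S.
Proof.
move=> eS /andP[r0 r1]; pose a : R := (rho^-1)%R; pose b : R := Num.sqrt (a ^+ 2 - 1)%R.
have a0 : (0 < a)%R by rewrite invr_gt0.
have a1 : (1 <= a ^+ 2)%R by rewrite exprn_ege1// invf_ge1// ltW.
have b0 : (0 <= b)%R by exact: sqrtr_ge0.
have b2 : (b ^+ 2 = a ^+ 2 - 1)%R by rewrite sqr_sqrtr// subr_ge0.
have ab : (a ^+ 2 - b ^+ 2 = 1)%R by rewrite b2 opprB addrC subrK.
have abN : (a ^+ 2 - (- b) ^+ 2 = 1)%R by rewrite sqrrN.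
rewrite !smeasureE//; last by move=> x [].
pose H := [set x : E | S x /\ (0 <= dot x e)%R].
apply: (@le_trans _ _ (hausdorff_outer n (mobius a b e @` H))).
  apply: le_hausdorff_outer => x [xS hx]; exists (mobius a (- b)%R e x); last first.
    by rewrite -{1}[b]opprK mobiusK.
  split; first exact: mobius_sphere.
  rewrite mobius_dot_axis//; apply: divr_ge0; last by rewrite ltW// mobius_den_gt0.
  rewrite subr_ge0; have : (b <= a * (1 - rho ^+ 2 / 2))%R.
    rewrite -(@ler_pXn2r _ 2)// ?nnegrE//; last first.
      by rewrite mulr_ge0// ?ltW// subr_gt0; nra.
    rewrite b2; have ar : (a * rho = 1)%R by rewrite mulVf// gt_eqF.
    have -> : ((a * (1 - rho ^+ 2 / 2)) ^+ 2 =
      a ^+ 2 - (a * rho) ^+ 2 + (a * rho) ^+ 2 * rho ^+ 2 / 4)%R by field.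
    by rewrite ar expr1n mul1r lerDl divr_ge0// sqr_ge0.
  by move=> /le_trans; apply; rewrite ler_wpM2l// ltW.
(* On the hemisphere [H] the denominators are at least [a], so the map is [rho]-Lipschitz there. *)
apply: (@le_trans _ _ ((rho ^+ n)%:E * hausdorff_outer n H)).
  apply: hausdorff_outer_lipschitz => // x y [xS xe] [yS ye].
  rewrite -[rho]invrK; apply: mobius_lipschitz => //; by rewrite lerDr mulr_ge0.
apply: lee_wpmul2l; first by rewrite lee_fin exprn_ge0// ltW.
by apply: le_hausdorff_outer => x [].
Qed.

(** For [rho < 1] the chordal ball is a cap, since the squared chord is [2 * (1 - dot x y)]; for
    larger [rho] the bound is at least [mu S]. *)
Lemma smeasure_ball_le (x : E) (rho : R) : S x -> (0 < rho)%R ->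
  mu [set y | S y /\ (enorm (x - y) <= rho)%R] <= (rho ^+ n)%:E * mu S.
Proof.
move=> xS r0; have [r1|r1] := ltP rho 1%R.
  apply: le_trans (smeasure_cap_le xS _); last by rewrite r0.
  rewrite !smeasureE//; [|by move=> y []|by move=> y []].
  apply: le_hausdorff_outer => y [yS xy]; split => //.
  have : (enorm (x - y) ^+ 2 <= rho ^+ 2)%R 
    by rewrite ler_pXn2r// nnegrE ?enorm_ge0// ltW.
  rewrite enorm_sqr dot_distE// dotC; lra.
rewrite !smeasureE//; last by move=> y [].
apply: (@le_trans _ _ (hausdorff n S)); first by apply: le_hausdorff_outer => y [].
rewrite -[leLHS]mul1e; apply: lee_wpmul2r; first exact: hausdorff_outer_ge0.
by rewrite lee_fin exprn_ege1.
Qed.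

(** The set where (1 + t) / (1 - t), the squared radius in stereographic projection from [e],
    exceeds [c]; clearing the denominator includes the pole [t = 1]. *)
Definition superlevel (e : E) (c : R) : set E :=
  [set x | S x /\ (c * (1 - dot x e) < 1 + dot x e)%R].

Lemma measurable_superlevel e c : measurable (superlevel e c).
Proof.
apply: (@measurable_sphere_height e [set t | (c * (1 - t) < 1 + t)%R]).
have -> : [set t : R | (c * (1 - t) < 1 + t)%R] =
      (fun t => (c * (1 - t) < 1 + t)%R) @^-1` [set true] by [].
rewrite -[X in measurable X]setTI; apply: measurable_fun_ltr => //.
  by apply: measurable_funM => //; apply: measurable_funB.
exact: measurable_funD.
Qed.

Lemma superlevel_anti e (c d : R) : S e -> (c <= d)%R -> superlevel e d `<=` superlevel e c.
Proof.
move=> eS cd x [xS h]; split => //; apply: le_lt_trans h; rewrite ler_wpM2r// subr_ge0.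
by have /andP[] := dot_sphere_itv xS eS.
Qed.

Definition shell (e : E) (c d : R) : set E := superlevel e c `\` superlevel e d.

Lemma measurable_shell e c d : measurable (shell e c d).
Proof. by apply: measurableD; exact: measurable_superlevel. Qed.

(* The Moebius map of ratio [l] multiplies (1 + t) / (1 - t) by [l ^+ 2]. *)
Lemma smeasure_shell_le (e : E) (c d l : R) : S e -> (1 <= l)%R ->
  mu (shell e c d) <= (l ^+ n)%:E * mu (shell e (c * l ^+ 2) (d * l ^+ 2)).
Proof.
move=> eS l1; have l0 : (0 < l)%R by exact: lt_le_trans l1.
(* Hyperbolic cosine and sine of the logarithm of [l], so that [a + b = l] and [a - b = l^-1]. *)
pose a : R := ((l + l^-1) / 2)%R; pose b : R := ((l - l^-1) / 2)%R.
have li : (l * l^-1 = 1)%R by rewrite mulfV// gt_eqF.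
have li0 : (0 < l^-1)%R by rewrite invr_gt0.
have a0 : (0 < a)%R by rewrite divr_gt0// addr_gt0.
have ab : (a ^+ 2 - b ^+ 2 = 1)%R.
  by rewrite -[RHS]li /a /b; move: (l^-1)%R => m; field.
have abN : (a ^+ 2 - (- b) ^+ 2 = 1)%R by rewrite sqrrN.
have aBb : (a - b = l^-1)%R by rewrite /a /b; move: (l^-1)%R => m; field.
have aDb : (a + b = l)%R by rewrite /a /b; move: (l^-1)%R => m; field.
have Q x k : S x -> superlevel e (k * l ^+ 2) (mobius a b e x) <-> superlevel e k x.
  move=> xS; have D0 := mobius_den_gt0 a0 ab eS xS.
  have -> : superlevel e (k * l ^+ 2) (mobius a b e x) <->
     (k * l ^+ 2 * (1 - dot (mobius a b e x) e) < 1 + dot (mobius a b e x) e)%R.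
    by split => [[]//|h]; split => //; exact: mobius_sphere.
  have -> : superlevel e k x <-> (k * (1 - dot x e) < 1 + dot x e)%R.
    by split => [[]//|h]; split.
  rewrite mobius_dot_axis//; move: (dot x e) D0 => t D0.
  have -> : (1 - (a * t + b) / (b * t + a) = l^-1 * (1 - t) / (b * t + a))%R.
    by rewrite -aBb; field; rewrite gt_eqF.
  have -> : (1 + (a * t + b) / (b * t + a) = l * (1 + t) / (b * t + a))%R.
    by rewrite -aDb; field; rewrite gt_eqF.
  have -> : (k * l ^+ 2 * (l^-1 * (1 - t) / (b * t + a)) = l * (k * (1 - t)) / (b * t + a))%R.
    by field; rewrite !gt_eqF.
  by rewrite ltr_pM2r ?invr_gt0// ltr_pM2l.
(* The inverse map has denominators at least [l^-1], hence is [l]-Lipschitz on the whole sphere. *)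
have denl t : (-1 <= t)%R -> (t <= 1)%R -> (l^-1 <= - b * t + a)%R.
  move=> t1 t2; rewrite -subr_ge0.
  have -> : (- b * t + a - l^-1 = b * (1 - t))%R by rewrite -aBb; ring.
  rewrite mulr_ge0 ?subr_ge0// divr_ge0// subr_ge0 (le_trans _ l1)// invf_le1//.
have shS k m : shell e k m `<=` S by move=> x [[]].
rewrite !smeasureE//.
apply: (@le_trans _ _
  (hausdorff_outer n (mobius a (- b)%R e @` shell e (c * l ^+ 2) (d * l ^+ 2)))).
  apply: le_hausdorff_outer => x [cx dx]; have xS : S x by case: cx.
  exists (mobius a b e x); last exact: mobiusK.
  by split; [apply/Q|move/(Q x d xS)].
apply: hausdorff_outer_lipschitz => // x y /shS xS /shS yS.
rewrite -[l in leRHS]invrK; apply: mobius_lipschitz => //.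
  have /andP[h1 h2] := dot_sphere_itv xS eS.
  exact: denl.
have /andP[h1 h2] := dot_sphere_itv yS eS.
exact: denl.
Qed.

(* The shells of levels [c * l ^+ (2 * j)] are disjoint and comparable. *)
Lemma smeasure_shell_small (e : E) (c l : R) (J : nat) : S e -> (0 <= c)%R -> (1 <= l)%R ->
  (forall j, (j < J)%N -> (l ^+ j <= 2)%R) ->
  J%:R%:E * mu (shell e c (c * l ^+ 2)) <= (2 ^+ n)%:E * mu S.
Proof.
move=> eS c0 l1 l2.
have l0 : (0 < l)%R by exact: lt_le_trans l1.
pose q j : R := (c * (l ^+ j) ^+ 2)%R.
have mQ j := measurable_superlevel e (q j).
have tele K : \sum_(j < K) mu (shell e (q j) (q j.+1)) + mu (superlevel e (q K)) =
    mu (superlevel e (q 0%N)).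
  elim: K => [|K ih]; first by rewrite big_ord0 add0e.
  rewrite big_ord_recr/= -ih -addeA; congr (_ + _).
  rewrite [RHS](smeasureD_fin (mQ K) (mQ K.+1)); congr (_ + mu _).
  apply/seteqP; split => [x h|x []//]; split => //; apply: superlevel_anti h => //.
  by rewrite /q ler_wpM2l// -!exprM ler_weXn2l// leq_mul2r leqnSn.
(* Moving the first shell onto the one of index [j] costs the factor [(l ^+ j) ^+ n], at most
   [2 ^+ n]. *)
have bound j : (j < J)%N ->
    mu (shell e c (c * l ^+ 2)) <= (2 ^+ n)%:E * mu (shell e (q j) (q j.+1)).
  move=> jJ; apply: le_trans (smeasure_shell_le c (c * l ^+ 2) eS (exprn_ege1 j l1)) _.
  rewrite (_ : (c * l ^+ 2 * (l ^+ j) ^+ 2 = q j.+1)%R); last first.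
    by rewrite /q -!exprM -mulrA -exprD mulSn.
  apply: lee_wpmul2r; first exact: measure_ge0.
  by rewrite lee_fin lerXn2r ?nnegrE ?exprn_ge0 ?(ltW l0)//; exact: l2.
apply: (@le_trans _ _ (\sum_(j < J) (2 ^+ n)%:E * mu (shell e (q j) (q j.+1)))).
  apply: (@le_trans _ _ (\sum_(j < J) mu (shell e c (c * l ^+ 2)))).
    by rewrite sumr_const card_ord mule_natl.
  by apply: lee_sum => j _; exact: bound.
rewrite -ge0_sume_distrr; last by move=> *; exact: measure_ge0.
apply: lee_wpmul2l; first by rewrite lee_fin exprn_ge0.
apply: (@le_trans _ _ (mu (superlevel e (q 0%N)))).
  by rewrite -(tele J) leeDl// measure_ge0.
apply: le_measure; rewrite ?inE//; first exact: measurable_sphere.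
by move=> x [].
Qed.

End measure_bounds.

(** * Finite perimeter of caps for kernels of order below [n.+1] *)

(** By induction (1 + x)^j (1 - j x) is at most 1, and the second factor is at least 1/2. This
    counts how many comparable shells are available. *)
Lemma expr_1Dx_le2 (R : realFieldType) (x : R) (j : nat) :
  0 <= x -> j%:R * x <= 1 / 2 -> (1 + x) ^+ j <= 2.
Proof.
move=> x0 jx; have : (1 + x) ^+ j * (1 - j%:R * x) <= 1.
  elim: j {jx} => [|j ih]; first by rewrite mul0r subr0 mulr1.
  apply: le_trans ih; rewrite exprSr -mulrA ler_wpM2l ?exprn_ge0 ?addr_ge0//.
  rewrite -natr1; have : 0 <= (j%:R : R) by exact: ler0n.
  by move: (j%:R : R) => k k0; nra.
have : 0 <= (1 + x) ^+ j by rewrite exprn_ge0// addr_ge0.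
move: ((1 + x) ^+ j) => y y0; nra.
Qed.

Section finite_perimeter.
Context (R : realType) (n : nat).
Local Notation E := (borel R n).
Local Notation S := (sphere R n).
Local Notation mu := (@smeasure R n).
Implicit Types (e : E) (t r : R).
Local Open Scope ereal_scope.

Definition strip e t r : set E := [set x | S x /\ (t < dot x e <= t + r)%R].

Lemma measurable_strip e t r : measurable (strip e t r).
Proof.
apply: (@measurable_sphere_height _ _ e [set u : R | (t < u <= t + r)%R]).
rewrite (_ : [set u | _] = `]t, (t + r)%R]%classic)//.
Qed.

(** The strip lies in a shell of ratio [l = 1 + k * r], which has about [(2 * (k * r))^-1] disjoint
    comparable dilates; so its measure is at most a multiple of [r]. For wide strips the area of the
    sphere is enough. *)
Lemma smeasure_strip_le e t : S e -> (-1 < t < 1)%R ->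
  exists2 K : R, (0 <= K)%R & forall r, (0 < r)%R -> mu (strip e t r) <= (K * r)%:E.
Proof.
move=> eS /andP[t0 t1].
have muS := smeasure_fin_num (@measurable_sphere R n).
pose M := fine (mu S); have M0 : (0 <= M)%R by rewrite fine_ge0.
have s0 : (0 < 1 + t)%R by lra.
have u0 : (0 < 1 - t)%R by lra.
(* With this [k], the increase [2 * (k * r)] of [l ^+ 2], multiplied by [(1 + t) * ((1 - t) / 2)],
   is exactly the [2 * r] required by the inclusion [sub] below. *)
pose k : R := (2 / ((1 + t) * (1 - t)))%R.
have k0 : (0 < k)%R by rewrite divr_gt0// mulr_gt0.
have kE : (k * (1 + t) * (1 - t) = 2)%R by rewrite /k -mulrA divfK// gt_eqF// mulr_gt0.
have A0 : (0 <= 2 ^+ n * M * (2 * k))%R.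
  by apply: mulr_ge0; [rewrite mulr_ge0// exprn_ge0|rewrite mulr_ge0// ltW].
have B0 : (0 <= M * 2 / (1 - t))%R by rewrite divr_ge0 ?mulr_ge0// ltW.
exists (2 ^+ n * M * (2 * k) + M * 2 / (1 - t))%R.
  exact: addr_ge0.
move=> r r0; rewrite mulrDl.
have [ru|ur] := leP r ((1 - t) / 2)%R; last first.
  apply: (@le_trans _ _ M%:E).
    rewrite /M fineK//; apply: le_measure; rewrite ?inE//.
    - exact: measurable_strip.
    - exact: measurable_sphere.
    - by move=> x [].
  rewrite lee_fin ler_wpDl//; first by rewrite mulr_ge0// ltW.
  have h1 : (1 <= 2 * r / (1 - t))%R.
    by rewrite ler_pdivlMr// mul1r; move: ur; rewrite ltr_pdivrMr//; lra.
  by have := ler_wpM2l M0 h1; rewrite mulr1 !mulrA [in X in (_ <= X)%R -> _]mulrAC.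
pose l : R := (1 + k * r)%R.
have kr0 : (0 < k * r)%R by rewrite mulr_gt0.
have l1 : (1 <= l)%R by rewrite /l; lra.
pose c : R := ((1 + t) / (1 - t))%R.
have c0 : (0 <= c)%R by rewrite divr_ge0// ltW.
pose J := (Num.truncn (2 * (k * r))^-1%R).+1.
have kr2 : (0 < 2 * (k * r))%R by rewrite mulr_gt0.
have lJ j : (j < J)%N -> (l ^+ j <= 2)%R.
  rewrite ltnS truncn_ge_nat; last by rewrite invr_ge0 ltW.
  rewrite -[(_^-1)%R]mul1r ler_pdivlMr// => jJ.
  by apply: expr_1Dx_le2; [exact: ltW|lra].
have sub : strip e t r `<=` shell e c (c * l ^+ 2).
  move=> x [xS /andP[h1 h2]]; split; first split => //.
    rewrite /c mulrAC ltr_pdivrMr//; nra.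
  move=> [_]; apply/negP; rewrite -leNgt.
  have -> : (c * l ^+ 2 * (1 - dot x e) = (1 + t) * l ^+ 2 * (1 - dot x e) / (1 - t))%R.
    by rewrite /c; field; rewrite gt_eqF.
  rewrite ler_pdivlMr//; move: (dot x e) h1 h2 => h h1 h2.
  have l2 : (1 + 2 * (k * r) <= l ^+ 2)%R.
    by rewrite /l; have := sqr_ge0 (k * r)%R; move: (k * r)%R => z; nra.
  have h3 : ((1 - t) / 2 <= 1 - h)%R by lra.
  have h4 : (0 <= (1 + t) * (1 - h))%R by rewrite mulr_ge0 ?(ltW s0)//; lra.
  have h5 := ler_wpM2r h4 l2.
  have h6 := mulr_ge0 (ltW kr2) (ltW s0).
  have h7 := ler_wpM2l h6 h3.
  have h8 : (2 * (k * r) * (1 + t) * ((1 - t) / 2) = 2 * r)%R.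
    by transitivity (k * (1 + t) * (1 - t) * r)%R; [field|rewrite kE].
  move: h5 h7; rewrite h8; move: (l ^+ 2)%R => L h5 h7; lra.
have key := smeasure_shell_small eS c0 l1 lJ.
have le1 : J%:R%:E * mu (strip e t r) <= (2 ^+ n)%:E * mu S.
  apply: le_trans key; apply: lee_wpmul2l; first by rewrite lee_fin.
  apply: le_measure; rewrite ?inE//; [exact: measurable_strip|exact: measurable_shell].
have fs := smeasure_fin_num (@measurable_strip e t r).
move: le1; rewrite -(fineK fs) -(fineK muS) -/M -!EFinM !lee_fin => le1.
apply: (@le_trans _ _ (2 ^+ n * M * (2 * k) * r)%R); last first.
  by rewrite lerDl mulr_ge0// ltW.
have JB : (1 <= J%:R * (2 * (k * r)))%R.
  by rewrite -ler_pdivrMr// mul1r ltW// truncnS_gt.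
have f0 : (0 <= fine (mu (strip e t r)))%R by rewrite fine_ge0.
have h1 := ler_wpM2r (ltW kr2) le1; have h2 := ler_wpM2l f0 JB.
by move: h1 h2; rewrite mulr1; lra.
Qed.

Definition height_cap e t : set E := [set x | S x /\ (t < dot x e)%R].

Lemma measurable_height_cap e t : measurable (height_cap e t).
Proof.
apply: (@measurable_sphere_height _ _ e [set u : R | (t < u)%R]).
by rewrite (_ : [set u | _] = `]t, +oo[%classic)//;
  apply/seteqP; split => u; rewrite /= in_itv/= andbT.
Qed.

Definition close_pairs e t r : set (E * E) :=
  [set z | [/\ height_cap e t z.1, (S `\` height_cap e t) z.2 &
            (enorm (z.1 - z.2) <= r)%R]].

Lemma measurable_close_pairs e t r : measurable (close_pairs e t r).
Proof.
have mC := measurable_height_cap e t.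
have -> : close_pairs e t r = (height_cap e t `*` (S `\` height_cap e t)) `&`
    (fun z : E * E => enorm (z.1 - z.2) <= r)%R @^-1` [set true].
  by apply/seteqP; split => -[x y]; [case|case=> -[]].
apply: measurableI.
  by apply: measurableX => //; apply: measurableD => //; exact: measurable_sphere.
rewrite -[X in measurable X]setTI; apply: measurable_fun_ler => //.
apply: (measurable_enorm (f := fun z : E * E => (z.1 - z.2)%R : E)).
rewrite (_ : (fun _ => _) =
  (fun z : E * E => 1 *: (z.1 : 'rV[R]_n.+1) + (-1) *: (z.2 : 'rV[R]_n.+1) : E)%R).
  exact: measurable_lin.
by apply/funext => z; rewrite scale1r scaleN1r.
Qed.

(** The height is 1-Lipschitz, so the first point of a close pair lies in a strip of width [r] and,
    given it, the second lies in a ball of radius [r]; the measures are of order [r] and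
    [r ^+ n]. *)
Lemma close_pairs_le e t : S e -> (-1 < t < 1)%R ->
  exists2 K : R, (0 <= K)%R & forall r, (0 < r)%R ->
    (mu \x mu) (close_pairs e t r) <= (K * r ^+ n.+1)%:E.
Proof.
move=> eS tt; have [K K0 stripK] := smeasure_strip_le eS tt.
have muS := smeasure_fin_num (@measurable_sphere R n).
exists (K * fine (mu S))%R; first by rewrite mulr_ge0// fine_ge0.
move=> r r0; have mW := measurable_close_pairs e t r; have mT := measurable_strip e t r.
pose B : \bar R := ((r ^+ n)%:E * mu S).
have B0 : 0 <= B by rewrite mule_ge0// lee_fin exprn_ge0// ltW.
have xs x : mu (xsection (close_pairs e t r) x) <= ((cst B) \_ (strip e t r)) x.
  rewrite patchE; case: ifPn => [/set_mem[xS _]|xT].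
    apply: le_trans (smeasure_ball_le xS r0).
    rewrite /smeasure /mrestr; apply: le_hausdorff_outer => y [+ yS].
    by rewrite /xsection/= inE => -[_ _ ?].
  rewrite [X in mu X](_ : _ = set0) ?measure0//.
  apply/seteqP; split => // y; rewrite /xsection/= inE => -[[/= xS xt] [yS yt] xy].
  move: xT; rewrite notin_setE; apply; split => //; rewrite xt/= -lerBlDl.
  have {yt} : (dot y e <= t)%R by rewrite leNgt; apply/negP => yt'; apply: yt.
  have := le_trans (ler_norm _) (dot_le_enorm (x - y) e).
  rewrite dotBl (sphere_enorm eS) mulr1; move: xy; move: (enorm _) => z; lra.
apply: (@le_trans _ _ (\int[mu]_x ((cst B) \_ (strip e t r)) x)).
  have mX : measurable_fun [set: E] (fun x => mu (xsection (close_pairs e t r) x)).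
    exact: measurable_fun_xsection.
  apply: ge0_le_integral.
  - exact: measurableT.
  - by move=> x _; exact: measure_ge0.
  - exact: mX.
  - exact: (measurable_restrictT _ mT).1 (measurable_cst _).
  - by move=> x _; exact: xs.
rewrite -integral_mkcond integral_cst// /B -(fineK muS).
apply: (@le_trans _ _ ((r ^+ n)%:E * (fine (mu S))%:E * (K * r)%:E)).
  by apply: lee_wpmul2l; [rewrite /B -(fineK muS) in B0|exact: stripK].
rewrite -!EFinM lee_fin exprSr !mulrA le_eqVlt; apply/orP; left; apply/eqP; ring.
Qed.

(** Dyadic decomposition: if [j] is the last index with [d <= 2 / 2 ^+ j], then [d] exceeds 2^-j and
    the term of index [j] alone dominates the kernel. Should [j] exceed [N], the term of index [N]
    dominates the truncation. *)
Lemma powR_min_le (p d : R) (N : nat) : (0 < p)%R -> (0 < d <= 2)%R ->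
  (Num.min (d `^ p)^-1 ((2 `^ p) ^+ N) <=
   \sum_(j < N.+1) (2 `^ p) ^+ j * (d <= 2 / 2 ^+ j)%R%:R)%R.
Proof.
move=> p0 /andP[d0 d2]; have Q0 : (0 < 2 `^ p :> R)%R by exact: powR_gt0.
elim: N => [|N ih].
  by rewrite big_ord_recr big_ord0/= add0r expr0 divr1 d2 mulr1 ge_min lexx orbT.
rewrite big_ord_recr/=; have [dN|dN] := leP d (2 / 2 ^+ N.+1)%R.
  rewrite mulr1 ge_min; apply/orP; right; rewrite lerDr; apply: sumr_ge0 => j _.
  by apply: mulr_ge0 => //; exact: exprn_ge0 (ltW Q0).
rewrite mulr0 addr0; apply: le_trans ih; rewrite ge_min le_min lexx/=.
apply/orP; left.
have dN' : (1 <= d * 2 ^+ N)%R.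
  by move: dN; rewrite exprS invfM mulrA divff// ltr_pdivrMr ?exprn_gt0// => /ltW.
have : (1 <= (d * 2 ^+ N) `^ p)%R.
  have one : (1 `^ p = 1 :> R)%R by rewrite powR1.
  by rewrite -[leLHS]one ge0_ler_powR ?nnegrE ?(ltW p0)// (le_trans _ dN').
rewrite powRM ?exprn_ge0 ?(ltW d0)// -powR_mulrn// powRAC powR_mulrn ?(ltW Q0)//.
by rewrite -ler_pdivrMl ?powR_gt0// mulr1.
Qed.

Lemma expr_unbounded (Q : R) (k : nat) : (1 < Q)%R -> exists N, (k%:R <= Q ^+ N)%R.
Proof.
move=> Q1; have bern N : (1 + N%:R * (Q - 1) <= Q ^+ N)%R.
  elim: N => [|N ih]; first by rewrite mul0r addr0.
  have Q0 : (0 <= Q)%R by lra.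
  rewrite exprS -natr1; apply: le_trans (ler_wpM2l Q0 ih).
  have : (0 <= N%:R * (Q - 1) ^+ 2)%R by rewrite mulr_ge0// sqr_ge0.
  by move: (N%:R : R)%R => m; nra.
exists (Num.truncn (k%:R / (Q - 1))%R).+1; apply: le_trans (bern _).
have : (k%:R / (Q - 1) <= (Num.truncn (k%:R / (Q - 1))%R).+1%:R)%R by exact/ltW/truncnS_gt.
by rewrite ler_pdivrMr ?subr_gt0//; lra.
Qed.

Lemma pair_int_sum_indic (W : nat -> set (E * E)) (c : nat -> R) (N : nat) :
  (forall j, measurable (W j)) -> (forall j, W j `<=` S `*` S) -> (forall j, 0 <= c j)%R ->
  pair_int (fun z => \sum_(j < N) c j * \1_(W j) z)%R =
  \sum_(j < N) (c j)%:E * (mu \x mu) (W j).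
Proof.
move=> mW WS c0.
have mi j : measurable_fun [set: E * E] (fun z : E * E => c j * \1_(W j) z)%R.
  by apply: measurable_funM => //; exact: measurable_indic.
have i0 j z : (0 <= c j * \1_(W j) z)%R by rewrite mulr_ge0// indic_ge0.
elim: N => [|N ih].
  rewrite big_ord0 /pair_int; apply: integral0_eq => z _.
  by rewrite big_ord0.
rewrite big_ord_recr/= -ih.
rewrite (@eq_pair_int _ _ _
  (fun z => \sum_(j < N) c j * \1_(W j) z + c N * \1_(W N) z)%R); last first.
  by move=> x y _ _; rewrite big_ord_recr.
rewrite pair_intD//; last 2 first.
- exact: measurable_sum.
- by move=> z; rewrite sumr_ge0.
rewrite pair_intZ//.
congr (_ + _ * _); rewrite /pair_int integral_indic//; last exact: measurable_SS.
by rewrite setIidl.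
Qed.

(** The pairs at scale [2 / 2 ^+ j] contribute at most [K * 2 ^+ n.+1 * q ^+ j]. Since [p < n.+1%:R]
    gives [q < 1], the geometric series bounds all truncations of [f] uniformly. *)
Lemma perim_height_cap_lty f (p : R) e t : nonlocal_kernel f ->
  (0 < p < n.+1%:R)%R ->
  (forall x y, S x -> S y -> x != y -> f (dot x y) <= (enorm (x - y) `^ p)^-1)%R ->
  S e -> (-1 < t < 1)%R -> perim f (height_cap e t) < +oo.
Proof.
move=> kf /andP[p0 pn] fp eS tt; have [K K0 leK] := close_pairs_le eS tt.
have mC := measurable_height_cap e t.
pose Q : R := (2 `^ p)%R; have Q0 : (0 < Q)%R by exact: powR_gt0.
have Q1 : (1 < Q)%R.
  have one : (1 `^ p = 1 :> R)%R by rewrite powR1.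
  by rewrite -[ltLHS]one gt0_ltr_powR ?nnegrE// ltr1n.
pose q : R := (Q / 2 ^+ n.+1)%R.
have q1 : (q < 1)%R.
  rewrite ltr_pdivrMr ?exprn_gt0// mul1r -powR_mulrn// /Q /powR !pnatr_eq0/=.
  by rewrite ltr_expR ltr_pM2r// ln_gt0// ltr1n.
have q0 : (0 <= q)%R by rewrite divr_ge0 ?exprn_ge0// ltW.
apply: (@le_lt_trans _ _ (K * 2 ^+ n.+1 / (1 - q))%:E); last exact: ltry.
apply: perim_trunc => // k; have kk := kernel_min kf (ler0n R k).
have [N kN] := expr_unbounded k Q1.
pose W j := close_pairs e t (2 / 2 ^+ j).
have mW j : measurable (W j) by exact: measurable_close_pairs.
have WS j : W j `<=` S `*` S by move=> [x y] [[xS _] [yS _] _].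
have Qj j : (0 <= Q ^+ j)%R by rewrite exprn_ge0// ltW.
apply: (@le_trans _ _ (pair_int (fun z => \sum_(j < N.+1) Q ^+ j * \1_(W j) z)%R)).
  apply: pair_int_le.
  - exact: measurable_nonlocal.
  - by apply: measurable_sum => j; apply: measurable_funM => //; exact: measurable_indic.
  - by move=> z; exact: nonlocal_ge0.
  - move=> x y xS yS; rewrite /nonlocal/= !indicE.
    have S0 : (0 <= \sum_(j < N.+1) Q ^+ j * \1_(W j) (x, y))%R.
      by apply: sumr_ge0 => j _; rewrite mulr_ge0// indic_ge0.
    have [/set_mem xC|_] := boolP (x \in height_cap e t); last by rewrite !mul0r.
    have [/set_mem yC|_] := boolP (y \in S `\` _); last by rewrite mulr0 mul0r.
    have xy : x != y by apply/eqP => xy; case: yC => _; rewrite -xy.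
    have d0 : (0 < enorm (x - y) <= 2)%R.
      rewrite lt_def enorm_eq0 subr_eq0 xy enorm_ge0/=.
      rewrite -(@ler_pXn2r _ 2)// ?nnegrE ?enorm_ge0// enorm_sqr dot_distE//.
      have /andP[h _] := dot_sphere_itv xS yS; lra.
    rewrite !mul1r; apply: (@le_trans _ _ (Num.min (enorm (x - y) `^ p)^-1 (Q ^+ N))%R).
      by rewrite le_min !ge_min fp// kN orbT.
    apply: le_trans (powR_min_le N p0 d0) _; apply: ler_sum => j _.
    rewrite indicE ler_wpM2l// ler_nat; case: (boolP (_ <= _)%R) => // h.
    by rewrite mem_set.
rewrite pair_int_sum_indic//.
apply: (@le_trans _ _ (\sum_(j < N.+1) (K * 2 ^+ n.+1 * q ^+ j)%:E)).
  apply: lee_sum => j _; have r0 : (0 < 2 / 2 ^+ j :> R)%R by rewrite divr_gt0 ?exprn_gt0.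
  apply: le_trans (lee_wpmul2l _ (leK _ r0)) _; first by rewrite lee_fin.
  rewrite -EFinM lee_fin /q !expr_div_n -!exprM (mulnC n.+1) le_eqVlt.
  apply/orP; left; apply/eqP.
  by move: (2 ^+ (j * n.+1))%R (2 ^+ n.+1)%R (Q ^+ j)%R => z w v; ring.
rewrite sumEFin lee_fin -mulr_sumr ler_wpM2l ?mulr_ge0 ?exprn_ge0//.
rewrite -[leRHS]mul1r ler_pdivlMr ?subr_gt0//.
suff -> : ((\sum_(i < N.+1) q ^+ i) * (1 - q) = 1 - q ^+ N.+1)%R by rewrite gerBl exprn_ge0.
elim: N.+1 => [|m ih]; first by rewrite big_ord0 mul0r expr0 subrr.
by rewrite big_ord_recr/= mulrDl ih exprS; ring.
Qed.

End finite_perimeter.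

(** * The geodesic angle as a function of the inner product *)

Section angle.
Context (R : realType).
Implicit Types u w p : R.

(* Outside of [-1, 1], [acos] takes junk values that would break monotonicity. *)
Definition angle u : R := if u < -1 then pi else if 1 < u then 0 else acos u.

Lemma angleE u : -1 <= u <= 1 -> angle u = acos u.
Proof. by case/andP => h1 h2; rewrite /angle ltNge h1/= ltNge h2. Qed.

Lemma ltr_acos u w : -1 <= u <= 1 -> -1 <= w <= 1 -> (acos w < acos u) = (u < w).
Proof.
move=> hu hw; rewrite -[in RHS](acosK hu) -[in RHS](acosK hw) ltr_cos//.
  by rewrite in_itv/= acos_ge0// acos_lepi.
by rewrite in_itv/= acos_ge0// acos_lepi.
Qed.

Lemma ler_acos u w : -1 <= u <= 1 -> -1 <= w <= 1 -> (acos w <= acos u) = (u <= w).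
Proof. by move=> hu hw; rewrite !leNgt ltr_acos. Qed.

Lemma angle_nonincreasing : nonincreasing_fun angle.
Proof.
move=> u w uw; rewrite /angle.
case: (ltP u (-1)) => hu; case: (ltP w (-1)) => hw.
- by [].
- by case: ltP => h; [exact: pi_ge0|apply: acos_lepi; rewrite hw].
- by have := le_lt_trans (le_trans hu uw) hw; rewrite ltxx.
- case: (ltP 1 u) => hu1; first by rewrite (lt_le_trans hu1 uw).
  case: (ltP 1 w) => hw1; first by apply: acos_ge0; rewrite hu.
  by rewrite ler_acos ?hu ?hw.
Qed.

Lemma measurable_angle : measurable_fun [set: R] angle.
Proof. by apply: nonincreasing_measurable => //; exact: angle_nonincreasing. Qed.

Lemma sin_le u : 0 <= u -> sin u <= u.
Proof.
move=> u0; have [c _] := @MVT_segment R sin cos 0 u u0 (fun x _ => is_derive_sin x)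
  (continuous_subspaceT (@continuous_sin R)).
rewrite sin0 !subr0 => ->; rewrite -[leRHS]mul1r ler_wpM2r// cos_le1.
Qed.

(** Half-angle formula and [sin_le]. In terms of distances: a chord is no longer than its arc. *)
Lemma cos_ge_quadratic u : 0 <= u <= pi -> 1 - cos u <= u ^+ 2 / 2.
Proof.
move=> /andP[u0 upi]; have uE : u = (u / 2) *+ 2 by rewrite -mulr_natr divfK.
rewrite [in leLHS]uE cos_mulr2n cos2sin2.
have s0 : 0 <= sin (u / 2).
  by apply: sin_ge0_pi; rewrite divr_ge0//= ler_pdivrMr// mulr_natr mulr2n ler_wpDr// pi_ge0.
have h : sin (u / 2) <= u / 2 by apply: sin_le; rewrite divr_ge0.
by move: (sin _) s0 h => y y0 h; nra.
Qed.

End angle.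

(** * Spherical caps *)

Section caps.
Context (R : realType) (n : nat).
Local Notation E := (borel R n).
Local Notation S := (sphere R n).
Local Notation mu := (@smeasure R n).
Implicit Types (A C : set E) (e v : E) (f : R -> R).

Lemma cap_height_cap v r : S v -> 0 <= r <= pi -> cap v r = height_cap v (cos r) :> set E.
Proof.
move=> vS rpi; have /andP[r0 _] := rpi.
apply/seteqP; split => x [xS].
  rewrite /gdist => h; split => //; have xv := dot_sphere_itv vS xS.
  rewrite dotC -[ltRHS]acosK// ltr_cos ?in_itv//=.
  by rewrite acos_ge0// acos_lepi.
rewrite dotC => h; split => //; have xv := dot_sphere_itv vS xS.
by rewrite /gdist -ltr_cos ?acosK// in_itv//= acos_ge0// acos_lepi.
Qed.

Lemma cap_sphere v r : S v -> pi < r -> cap v r = S :> set E.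
Proof.
move=> vS rpi; apply/seteqP; split => x; first by case.
move=> xS; split => //; apply: le_lt_trans rpi; apply: acos_lepi.
exact: dot_sphere_itv.
Qed.

Lemma centered_height_cap e t : centered e (height_cap e t : set E).
Proof.
split; first exact: measurable_height_cap.
  by move=> x [].
by move=> x y [xS xt] yS xy; split => //; exact: lt_le_trans xy.
Qed.

Lemma centered_cap v r : S v -> 0 <= r -> centered v (cap v r : set E).
Proof.
move=> vS r0; have [rpi|rpi] := leP r pi.
  by rewrite cap_height_cap ?r0//; exact: centered_height_cap.
by rewrite cap_sphere//; split => //; exact: measurable_sphere.
Qed.

(** A reflection exchanging the centres carries one cap onto the other. *)
Lemma smeasure_cap v e r : S v -> S e -> mu (cap e r) = mu (cap v r).
Proof.
move=> vS eS; have [->//|ev] := eqVneq e v.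
have [w wS we] := exists_refl eS vS ev.
rewrite -[RHS](smeasure_refl _ wS); congr smeasure; apply/seteqP.
split => x [xS xr]; split.
- exact/refl_sphere.
- by rewrite /gdist -we dot_refl.
- by apply/(refl_sphere _ wS).
- by move: xr; rewrite /gdist -we dot_refl.
Qed.

Local Open Scope ereal_scope.

(** Each truncated kernel is bounded, so its integral is at most a multiple of the vanishing
    product. This settles empty and full caps. *)
Lemma perim_null f A : nonlocal_kernel f -> measurable A -> A `<=` S ->
  mu A * mu (S `\` A) = 0 -> perim f A = 0.
Proof.
move=> kf mA AS A0; apply/eqP; rewrite eq_le pair_int_ge0 ?andbT; last first.
  by move=> z; exact: nonlocal_ge0.
have mSA : measurable (S `\` A) by apply: measurableD => //; exact: measurable_sphere.
apply: perim_trunc => // k; have kk := kernel_min kf (ler0n R k).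
apply: (@le_trans _ _ (pair_int (fun z : E * E => k%:R * \1_(A `*` (S `\` A)) z)%R)).
  apply: pair_int_le.
  - exact: measurable_nonlocal.
  - by apply: measurable_funM => //; apply: measurable_indic; exact: measurableX.
  - by move=> z; exact: nonlocal_ge0.
  - move=> x y _ _; rewrite /nonlocal/= !indicE in_setX/= -natrM mulnb mulrC.
    by rewrite ler_wpM2r// ge_min lexx orbT.
by rewrite pair_int_setX// A0 mule0.
Qed.

(** Only the antipode of [e] is left. It lies in caps of measure at most [rho ^+ n] times [mu S],
    and [1 <= n] bounds [rho ^+ n] by [rho], which is arbitrarily small. *)
Lemma smeasure_antipode e : (1 <= n)%N -> S e -> mu (S `\` height_cap e (-1)%R) = 0.
Proof.
move=> n1 eS; have mS := @measurable_sphere R n.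
have muS := smeasure_fin_num mS.
have mA : measurable (S `\` height_cap e (-1)%R : set E).
  by apply: measurableD => //; exact: measurable_height_cap.
have fA := smeasure_fin_num mA.
have eS' : S (- e)%R by exact/sphereN.
have le1 (rho : R) : (0 < rho < 1)%R ->
    (fine (mu (S `\` height_cap e (-1)%R)) <= rho * fine (mu S))%R.
  move=> rr; have /andP[r0 r1] := rr.
  rewrite -lee_fin EFinM !fineK//.
  apply: (@le_trans _ _ ((rho ^+ n)%:E * mu S)); last first.
    apply: lee_wpmul2r; first exact: measure_ge0.
    by rewrite lee_fin -[leRHS]expr1 ler_wiXn2l// ltW.
  apply: le_trans (smeasure_cap_le eS' rr); apply: le_measure; rewrite ?inE//.
    by apply: (@measurable_sphere_height _ _ (- e)%R [set u : R | (1 - rho ^+ 2 / 2 <= u)%R]);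
      rewrite (_ : [set u | _] = `[(1 - rho ^+ 2 / 2)%R, +oo[%classic)//;
      apply/seteqP; split => u; rewrite /= in_itv/= andbT.
  move=> x [xS nx]; split => //; rewrite dotNr.
  have : (dot x e <= -1)%R by rewrite leNgt; apply/negP => h; apply: nx.
  have := sqr_ge0 rho; lra.
have f0 : (0 <= fine (mu (S `\` height_cap e (-1)%R)))%R by rewrite fine_ge0.
have M0 : (0 <= fine (mu S))%R by rewrite fine_ge0.
rewrite -(fineK fA); congr EFin; apply/eqP; rewrite eq_le f0 andbT.
apply/ler_addgt0Pr => eps eps0; rewrite add0r.
pose rho : R := (eps / (eps + fine (mu S) + 1))%R.
have d0 : (0 < eps + fine (mu S) + 1)%R by lra.
apply: le_trans (le1 rho _) _.
  by rewrite divr_gt0//= ltr_pdivrMr//; lra.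
rewrite /rho mulrAC ler_pdivrMr// ler_wpM2l ?(ltW eps0)//; lra.
Qed.

(** Degenerate caps, of height 1 or -1 or with [pi < r], are null or have a null complement; the
    others fall under [perim_height_cap_lty]. *)
Lemma perim_cap_lty f (p : R) C : (1 <= n)%N -> nonlocal_kernel f -> (0 < p < n.+1%:R)%R ->
  (forall x y, S x -> S y -> x != y -> f (dot x y) <= (enorm (x - y) `^ p)^-1)%R ->
  spherical_cap C -> perim f C < +oo.
Proof.
move=> n1 kf pp fp [v [r [vS r0 ->]]].
have [mC CS _] := centered_cap vS r0.
have [rpi|rpi] := leP r pi; last first.
  by rewrite perim_null// cap_sphere// setDv measure0 mule0.
have rpi' : (0 <= r <= pi)%R by rewrite r0.
have ch := cap_height_cap vS rpi'.
have /andP[c1 c2] : (-1 <= cos r <= 1)%R by rewrite cos_geN1 cos_le1.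
have [e1|cr1] := eqVneq (cos r) 1%R.
  rewrite perim_null// [X in mu X * _](_ : _ = set0) ?measure0 ?mul0e//.
  rewrite ch e1; apply/seteqP; split => // x [xS].
  by have /andP[_ h] := dot_sphere_itv xS vS; rewrite ltNge h.
have [e1|crN1] := eqVneq (cos r) (-1)%R.
  by rewrite perim_null// ch e1 smeasure_antipode// mule0.
by rewrite ch (perim_height_cap_lty kf pp fp vS)// !lt_neqAle c1 c2 cr1 eq_sym crN1.
Qed.

(** The error terms of [perim_continuity] vanish here; its bound on the kernel is obtained by
    truncation. *)
Lemma perim_eq_ae f A C : nonlocal_kernel f -> measurable A -> measurable C ->
  A `<=` S -> C `<=` S -> mu (A `\` C) = 0 -> mu (C `\` A) = 0 -> perim f A = perim f C.
Proof.
move=> kf mA mC AS CS.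
suff le1 B D : measurable B -> measurable D -> B `<=` S -> D `<=` S ->
    mu (B `\` D) = 0 -> mu (D `\` B) = 0 -> perim f B <= perim f D.
  by move=> h1 h2; apply/eqP; rewrite eq_le !le1.
move=> mB mD BS DS h1 h2; apply: perim_trunc => // k.
have kk := kernel_min kf (ler0n R k).
have := @perim_continuity _ _ _ B D k%:R kk _ mB mD BS DS.
rewrite h1 h2 mul0e mule0 !mule0 !adde0 => /(_ _)/le_trans; apply.
  by move=> u; rewrite ge_min lexx orbT.
apply: pair_int_le.
- exact: measurable_nonlocal.
- exact: measurable_nonlocal.
- by move=> z; exact: nonlocal_ge0.
- move=> x y _ _; apply: ler_wpM2l; first by rewrite mulr_ge0// indic_ge0.
  by rewrite ge_min lexx.
Qed.

Lemma perim_cap_comparison f A C : nonlocal_kernel f ->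
  {in `[(-1)%R, 1%R[ &, {homo f : u w / (u < w)%R}} ->
  measurable A -> A `<=` S -> spherical_cap C -> mu A = mu C -> perim f C < +oo ->
  perim f C <= perim f A /\ (perim f A = perim f C <-> spherical_cap_ae A).
Proof.
move=> kf fs mA AS capC muAC Cfin; have [v [r [vS r0 CE]]] := capC.
have cC : centered v C by rewrite CE; exact: centered_cap.
have [mC CS _] := cC.
split; first exact: perim_centered_le cC mA AS muAC.
split => [PAC|[C' [v' [r' [v'S r'0 C'E]]] AC']].
  have caps e : S e -> centered e (cap e r) /\ mu (cap e r) = mu C.
    by move=> eS; split; [exact: centered_cap|rewrite CE; exact: smeasure_cap].
  have [e eS [AC CA]] := perim_centered_eq kf fs caps cC mA AS muAC Cfin PAC.
  exists (cap e r); first by exists e, r.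
  have [mC' C'S _] := centered_cap eS r0.
  have mD := measurableD mA mC'; have mD' := measurableD mC' mA.
  rewrite -smeasureE; last by move=> x [[/AS]|[/C'S]].
  apply/eqP; rewrite eq_le measure_ge0 andbT.
  apply: le_trans (measureU2 mu mD mD') _; rewrite -[leRHS]adde0.
  by apply: leeD; rewrite le_eqVlt; apply/orP; left; apply/eqP; [exact: AC|exact: CA].
have cC' : centered v' C' by rewrite C'E; exact: centered_cap.
have [mC' C'S _] := cC'.
have mD := measurableD mA mC'; have mD' := measurableD mC' mA.
have null D : measurable D -> D `<=` A `+` C' -> mu D = 0.
  move=> mD0 DAC; apply/eqP; rewrite eq_le measure_ge0 andbT -AC' smeasureE.
    exact: le_hausdorff_outer.
  by move=> x /DAC[[/AS]|[/C'S]].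
have AC0 : mu (A `\` C') = 0 by apply: null => // x; left.
have CA0 : mu (C' `\` A) = 0 by apply: null => // x; right.
(* The cap [C'] may have another centre than [C]; equal measure and minimality in both directions
   identify their perimeters. *)
have muAC' : mu C' = mu C.
  rewrite -muAC (smeasureD_fin mA mC') (smeasureD_fin mC' mA).
  by rewrite AC0 CA0 setIC.
rewrite (perim_eq_ae kf mA mC' AS C'S AC0 CA0); apply/eqP; rewrite eq_le.
by rewrite (perim_centered_le kf cC' mC CS) ?(perim_centered_le kf cC mC' C'S).
Qed.

End caps.

(** * Power kernels of the geodesic distance *)

Section riesz_kernel.
Context (R : realType) (n : nat).
Local Notation E := (borel R n).
Local Notation S := (sphere R n).
Local Notation mu := (@smeasure R n).
Implicit Types (A C : set E) (p u w : R).

Lemma smeasure_compl_eq A C : measurable A -> measurable C -> A `<=` S -> C `<=` S ->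
  mu A = mu C -> mu (S `\` A) = mu (S `\` C).
Proof.
move=> mA mC AS CS AC; have mS := @measurable_sphere R n.
have := smeasureD_fin mS mC; rewrite (smeasureD_fin mS mA) !setIidr// AC => h.
have fC := smeasure_fin_num mC.
by apply/eqP; rewrite eq_le -(leeD2rE _ _ fC) h lexx/= -(leeD2rE _ _ fC) h.
Qed.

Definition riesz p (u : R) : R := angle u `^ (- p).

Lemma measurable_riesz p : measurable_fun [set: R] (riesz p).
Proof. exact: measurableT_comp (measurable_powR _) (@measurable_angle R). Qed.

Lemma rieszE p (x y : E) : S x -> S y -> (gdist x y `^ p)^-1 = riesz p (dot x y).
Proof. by move=> xS yS; rewrite /riesz angleE ?powRN//; exact: dot_sphere_itv. Qed.

Lemma frac_perimeterE s A : measurable A -> A `<=` S ->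
  frac_perimeter s A = perim (riesz (n%:R + s)) A.
Proof.
move=> mA AS; have mS := @measurable_sphere R n.
rewrite /frac_perimeter (pair_int_iterated (g := fun z => riesz (n%:R + s) (dot z.1 z.2)))//.
- exact: measurableD.
- by apply: (measurableT_comp (measurable_riesz _)); exact: measurable_dot.
- by move=> z; exact: powR_ge0.
- by move=> x y /AS xS [yS _]; exact: rieszE.
Qed.

Lemma angle_gt0 u : -1 <= u < 1 -> 0 < angle u.
Proof. by move=> /andP[h1 h2]; rewrite angleE ?h1 ?ltW// acos_gt0// h1. Qed.

Lemma angle_lt u w : u \in `[-1, 1[ -> w \in `[-1, 1[ -> u < w -> angle w < angle u.
Proof.
rewrite !in_itv/= => /andP[u1 u2] /andP[w1 w2] uw.
by rewrite !angleE ?u1 ?w1 ?ltW// ltr_acos ?u1 ?w1 ?ltW.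
Qed.

Lemma riesz_lt p : 0 < p -> {in `[-1, 1[ &, {homo riesz p : u w / u < w}}.
Proof.
move=> p0 u w hu hw uw; have au := angle_gt0 hu; have aw := angle_gt0 hw.
rewrite /riesz !powRN ltf_pV2 ?posrE ?powR_gt0//.
by apply: gt0_ltr_powR => //; rewrite ?nnegrE ?(ltW au) ?(ltW aw)//; exact: angle_lt.
Qed.

Lemma riesz_kernel p : 0 < p -> nonlocal_kernel (riesz p).
Proof.
move=> p0; split; [exact: measurable_riesz|by move=> u; exact: powR_ge0|].
move=> u w hu hw; rewrite le_eqVlt => /predU1P[->//|uw].
exact/ltW/riesz_lt.
Qed.

(** The chord is at most the arc by [cos_ge_quadratic], and a negative power reverses the
    comparison. *)
Lemma riesz_le_enorm p (x y : E) : 0 < p -> S x -> S y -> x != y ->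
  riesz p (dot x y) <= (enorm (x - y) `^ p)^-1.
Proof.
move=> p0 xS yS xy; have xy1 := dot_sphere_itv xS yS.
have e0 : 0 < enorm (x - y) by rewrite lt_def enorm_eq0 subr_eq0 xy enorm_ge0.
have le1 : enorm (x - y) <= acos (dot x y).
  rewrite -(@ler_pXn2r _ 2)// ?nnegrE ?enorm_ge0 ?acos_ge0// enorm_sqr dot_distE//.
  have := @cos_ge_quadratic R (acos (dot x y)); rewrite acos_ge0// acos_lepi// => /(_ isT).
  by rewrite acosK//; lra.
rewrite -rieszE// lef_pV2 ?posrE ?powR_gt0//; last exact: lt_le_trans le1.
by apply: ge0_ler_powR; rewrite ?nnegrE ?(ltW p0) ?(ltW e0)// acos_ge0.
Qed.

(* For negative exponents the kernel is bounded and decreasing in the height;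
   its complement is a kernel again. *)
Definition coriesz p (u : R) : R := pi `^ (- p) - riesz p u.

Lemma angle_ge0_lepi u : 0 <= angle u <= pi.
Proof.
rewrite /angle; case: ltP => h; first by rewrite pi_ge0 lexx.
by case: ltP => h'; [rewrite lexx pi_ge0|rewrite acos_ge0 ?acos_lepi ?h].
Qed.

Lemma riesz_le_pi p u : p < 0 -> riesz p u <= pi `^ (- p).
Proof.
move=> p0; have /andP[a0 api] := angle_ge0_lepi u.
by apply: ge0_ler_powR; rewrite ?nnegrE ?pi_ge0// oppr_ge0 ltW.
Qed.

Lemma coriesz_lt p : p < 0 -> {in `[-1, 1[ &, {homo coriesz p : u w / u < w}}.
Proof.
move=> p0 u w hu hw uw; rewrite ltrD2l ltrN2.
have /andP[a0 _] := angle_ge0_lepi u; have /andP[b0 _] := angle_ge0_lepi w.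
by apply: gt0_ltr_powR; rewrite ?nnegrE ?oppr_gt0//; exact: angle_lt.
Qed.

Lemma coriesz_kernel p : p < 0 -> nonlocal_kernel (coriesz p).
Proof.
move=> p0; split.
- by apply: measurable_funB => //; exact: measurable_riesz.
- by move=> u; rewrite subr_ge0 riesz_le_pi.
- by move=> u w hu hw; rewrite le_eqVlt => /predU1P[->//|uw]; exact/ltW/coriesz_lt.
Qed.

Local Open Scope ereal_scope.

(** The two kernels add up to a constant, so the sum of the perimeters depends only on measures:
    minimizing one is maximizing the other. *)
Lemma perim_coriesz p A : (p < 0)%R -> measurable A -> A `<=` S ->
  perim (riesz p) A + perim (coriesz p) A = (pi `^ (- p))%:E * (mu A * mu (S `\` A)).
Proof.
move=> p0 mA AS; have mS := @measurable_sphere R n; have mSA := measurableD mS mA.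
have c0 : (0 <= pi `^ (- p) :> R)%R by exact: powR_ge0.
rewrite -pair_int_setX//.
have ii : measurable_fun [set: E * E] (fun z : E * E => \1_A z.1 * \1_(S `\` A) z.2 : R)%R.
  by apply: measurable_funM; apply: measurableT_comp => //; exact: measurable_indic.
rewrite -pair_intD.
- by apply: eq_pair_int => x y _ _;
    rewrite /nonlocal/= /coriesz !indicE in_setX/= -mulnb natrM; ring.
- apply: measurable_funM => //; apply: (measurableT_comp (measurable_riesz _)).
  exact: measurable_dot.
- exact: measurable_nonlocal (coriesz_kernel p0) mA.
- by move=> z; rewrite !mulr_ge0 ?indic_ge0 ?powR_ge0.
- by move=> z; exact: nonlocal_ge0 (coriesz_kernel p0).
Qed.

End riesz_kernel.

Theorem theorem3p1 (R : realType) (n : nat) (E C : set (borel R n)) :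
  (1 <= n)%N ->
  measurable E -> E `<=` sphere R n ->
  spherical_cap C ->
  hausdorff n E = hausdorff n C ->
  (forall s : R, - n%:R < s < 1 ->
     (frac_perimeter s C <= frac_perimeter s E)%E /\
     (frac_perimeter s E = frac_perimeter s C <-> spherical_cap_ae E)) /\
  (forall s : R, s < - n%:R ->
     (frac_perimeter s E <= frac_perimeter s C)%E /\
     (frac_perimeter s E = frac_perimeter s C <-> spherical_cap_ae E)).
Proof.
move=> n1 mE ES capC HEC; have [v [r [vS r0 CE]]] := capC.
have [mC CS _] : centered v C by rewrite CE; exact: centered_cap.
have muEC : smeasure E = smeasure C by rewrite !smeasureE.
split => s hs; rewrite !frac_perimeterE//.
  (* The exponent lies strictly between 0 and [n.+1%:R], where the kernel is increasing and caps
     have finite perimeter. *)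
  have p0 : 0 < n%:R + s by move: hs => /andP[]; lra.
  have kf := riesz_kernel p0.
  apply: (perim_cap_comparison kf (riesz_lt p0)) => //.
  apply: (perim_cap_lty n1 kf (p := n%:R + s)) => //.
    by rewrite p0/= -natr1 ltrD2l; case/andP: hs.
  by move=> x y xS yS xy; exact: riesz_le_enorm.
(* The exponent is now negative, and the comparison is applied to the complementary kernel
   [coriesz]. *)
have p0 : n%:R + s < 0 by lra.
have kL := coriesz_kernel p0.
have mSE := measurableD (@measurable_sphere R n) mE.
have mSC := measurableD (@measurable_sphere R n) mC.
have muD := smeasure_compl_eq mE mC ES CS muEC.
have sumE := perim_coriesz p0 mE ES; have sumC := perim_coriesz p0 mC CS.
have n0 (k : R -> R) (A : set (borel R n)) :
    (forall u, 0 <= k u) -> (0 <= perim k A)%E.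
  move=> k0; apply: pair_int_ge0 => z.
  by apply: mulr_ge0 => //; apply: mulr_ge0; exact: indic_ge0.
have rE := n0 _ E (fun u => powR_ge0 _ _ : 0 <= riesz (n%:R + s) u).
have rC := n0 _ C (fun u => powR_ge0 _ _ : 0 <= riesz (n%:R + s) u).
have [_ L0 _] := kL.
(* All four perimeters are finite, so the common sum can be rearranged in the reals, which reverses
   the inequality. *)
have Vfin : (perim (riesz (n%:R + s)) E + perim (coriesz (n%:R + s)) E \is a fin_num)%E.
  by rewrite sumE !fin_numM// smeasure_fin_num.
have sums : (perim (riesz (n%:R + s)) E + perim (coriesz (n%:R + s)) E =
    perim (riesz (n%:R + s)) C + perim (coriesz (n%:R + s)) C)%E.
  by rewrite sumE sumC muEC muD.
have := Vfin; rewrite sums fin_numD => /andP[rCfin LCfin].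
move: Vfin; rewrite fin_numD => /andP[rEfin LEfin].
have LClt : (perim (coriesz (n%:R + s)) C < +oo)%E by rewrite ltey_eq LCfin.
have [le1 iffL] := perim_cap_comparison kL (coriesz_lt p0) mE ES capC muEC LClt.
suff [leE iffE] : (perim (riesz (n%:R + s)) E <= perim (riesz (n%:R + s)) C)%E /\
    (perim (riesz (n%:R + s)) E = perim (riesz (n%:R + s)) C <->
     perim (coriesz (n%:R + s)) E = perim (coriesz (n%:R + s)) C).
  by split => //; exact: iff_trans iffL.
move: sums le1; rewrite -(fineK rCfin) -(fineK LCfin) -(fineK rEfin) -(fineK LEfin).
rewrite -!EFinD !lee_fin => -[sums] le1; split; first lra.
by split => -[h]; congr EFin; lra.
Qed.
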